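(* There exists a universal constant $b>0$ such that the following holds for every finite group $G$ with $|G|\ge 2$, every integer $n\ge 1$ and every real $c>0$ for which $$k=\tfrac12 n\log n+\tfrac14 n\log(|G|-1)+cn$$ is an integer. Let $P$ be the one-step distribution of the independent shuffles random walk on $G\wr S_n$ and let $U$ be the uniform probability measure on $G\wr S_n$ (both defined in the context). Then $$\|P^{*k}-U\|_{\mathrm{TV}}\ \le\ \tfrac12\left(|G|^n\,n!\right)^{1/2}\|P^{*k}-U\|_2\ \le\ b\,e^{-2c}.$$
   Context: The complete monomial group (wreath product) $G\wr S_n$ is the set $G^n\times S_n$, with elements written $(\vec x;\pi)$, $\vec x=(x_1,\dots,x_n)\in G^n$, $\pi\in S_n$, and multiplication $(\vec y;\sigma)(\vec x;\pi)=(y_1x_{\sigma^{-1}(1)},\dots,y_nx_{\sigma^{-1}(n)};\sigma\pi)$. It has $|G|^n n!$ elements and identity $(\vec e;e)$, where $\vec e=(e,\dots,e)$. The independent shuffles measure $P$ on $G\wr S_n$ is the probability mass function: - $P(\vec e;e)=\frac{1}{|G|n}$; - $P(\vec u;e)=\frac{1}{|G|n^2}$ if $\vec u\in G^n$ has exactly one non-identity entry; - $P(\vec v;\tau)=\frac{2}{|G|^2n^2}$ if $\tau=(p\ q)\in S_n$ is a transposition and all entries of $\vec v\in G^n$ outside positions $p$ and $q$ are the identity (the entries in positions $p,q$ being arbitrary); - $P(\vec x;\pi)=0$ otherwise. The uniform measure is $U(\vec x;\pi)=\frac{1}{|G|^n n!}$. For functions $P,Q$ on a finite group $\Gamma$: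 convolution is $P*Q(g)=\sum_{h\in\Gamma}P(gh^{-1})Q(h)$, and $P^{*k}$ is the $k$-fold convolution power; $\|P-Q\|_{\mathrm{TV}}=\max_{A\subseteq \Gamma}|P(A)-Q(A)|$; $\|P-Q\|_2=\left(\sum_{g\in\Gamma}|P(g)-Q(g)|^2\right)^{1/2}$. Here $\log$ is the natural logarithm. *)

(* Defs.v *)
From HB Require Import structures.
From mathcomp Require Import all_boot all_fingroup.
Set Implicit Arguments.
Unset Strict Implicit.
Unset Printing Implicit Defensive.

(* The carrier is a fresh record, not a product type, because a product of
   finite groups already carries the componentwise (direct product) law. *)
Record wreath (gT : finGroupType) (n : nat) := Wreath {
  wbase : {ffun 'I_n -> gT};
  wperm : 'S_n }.

Section WreathGroup.
Variables (gT : finGroupType) (n : nat).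
Implicit Types u v w : wreath gT n.
Local Open Scope group_scope.

Definition wreath_pair u := (wbase u, wperm u).
Definition pair_wreath (p : {ffun 'I_n -> gT} * 'S_n) := Wreath p.1 p.2.

Lemma wreath_pairK : cancel wreath_pair pair_wreath.
Proof. by case. Qed.

Lemma pair_wreathK : cancel pair_wreath wreath_pair.
Proof. by case. Qed.

HB.instance Definition _ := Finite.copy (wreath gT n) (can_type wreath_pairK).

Definition wreath_one : wreath gT n := Wreath [ffun=> 1] 1.

(* Permutations compose right to left in (y;s)(x;t) = (y_i x_{s^-1(i)}; s t),
   whereas the product of {perm T} is read left to right: (t * s) i = s (t i). *)
Definition wreath_mul u v : wreath gT n :=
  Wreath [ffun i => wbase u i * wbase v ((wperm u)^-1 i)] (wperm v * wperm u).

Definition wreath_inv u : wreath gT n :=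
  Wreath [ffun i => (wbase u (wperm u i))^-1] (wperm u)^-1.

Lemma wreath_mulA : associative wreath_mul.
Proof.
move=> [x r] [y s] [z t]; rewrite /wreath_mul /= mulgA; congr Wreath.
by apply/ffunP=> i; rewrite !ffunE /= invMg permM mulgA.
Qed.

Lemma wreath_mul1 : left_id wreath_one wreath_mul.
Proof.
move=> [x s]; rewrite /wreath_mul /= mulg1; congr Wreath.
by apply/ffunP=> i; rewrite !ffunE invg1 perm1 mul1g.
Qed.

Lemma wreath_mulV : left_inverse wreath_one wreath_inv wreath_mul.
Proof.
move=> [x s]; rewrite /wreath_mul /wreath_one /= mulgV; congr Wreath.
by apply/ffunP=> i; rewrite !ffunE invgK mulVg.
Qed.

HB.instance Definition _ := Finite_isGroup.Build (wreath gT n)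
  wreath_mulA wreath_mul1 wreath_mulV.

Lemma card_wreath : #|{: wreath gT n}| = (#|gT| ^ n * n`!)%N.
Proof.
rewrite (bij_eq_card (Bijective wreath_pairK pair_wreathK)) card_prod card_ffun.
by rewrite card_ord card_Sn.
Qed.

End WreathGroup.

From mathcomp Require Import all_order all_algebra reals.
Import Order.TTheory GRing.Theory Num.Theory.
Local Open Scope ring_scope.

Section FiniteGroupFunctions.
Variables (R : realType) (T : finGroupType).
Implicit Types P Q : T -> R.

Definition convol P Q : T -> R := fun g => \sum_(h : T) P (g * h^-1)%g * Q h.

Definition convol_pow P (k : nat) : T -> R :=
  iter k (convol P) (fun g => (g == 1%g)%:R).

(* The default 0 is itself attained, at A = set0. *)
Definition tv_dist P Q : R :=
  \big[Num.max/0]_(A : {set T}) `|\sum_(g in A) P g - \sum_(g in A) Q g|.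

Definition l2_dist P Q : R := Num.sqrt (\sum_(g : T) `|P g - Q g| ^+ 2).

End FiniteGroupFunctions.

Section IndependentShuffles.
Variables (R : realType) (gT : finGroupType) (n : nat).

Definition wsupp (u : wreath gT n) : {set 'I_n} :=
  [set i | wbase u i != 1%g].

Definition is_shuffled_transposition (u : wreath gT n) : bool :=
  [exists p : 'I_n, exists q : 'I_n,
     [&& p != q, wperm u == tperm p q & wsupp u \subset [set p; q]]].

Definition indep_shuffles (u : wreath gT n) : R :=
  if (wperm u == 1%g) && (#|wsupp u| == 0%N) then (#|gT|%:R * n%:R)^-1
  else if (wperm u == 1%g) && (#|wsupp u| == 1%N) then
    (#|gT|%:R * n%:R ^+ 2)^-1
  else if is_shuffled_transposition u then 2 / (#|gT|%:R ^+ 2 * n%:R ^+ 2)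
  else 0.

Definition wreath_unif (u : wreath gT n) : R := ((#|gT| ^ n * n`!)%N%:R)^-1.

End IndependentShuffles.

(* Main.v *)
Require Import Defs.
From HB Require Import structures.
From mathcomp Require Import all_boot all_order all_algebra all_fingroup.
From mathcomp Require Import action algC mxrepresentation classfun character.
From mathcomp Require Import inertia zify ring lra.
From mathcomp Require Import reals sequences exp.
Set Implicit Arguments.
Unset Strict Implicit.
Unset Printing Implicit Defensive.
Import Order.TTheory GRing.Theory Num.Theory.
Local Open Scope ring_scope.

(** One step of the walk resamples two independent uniform positions [p], [q]
    (possibly equal) and applies [tperm p q].  Splitting each coordinate into
    constants and their complement, [convol_pow P m] is a sum over the sets [S] of
    positions of a product function times the [m]-step walk on [Sym S] whose step
    is [\sum_(p in S) \sum_(q in S) tperm p q]; hence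
    [#|W| * (P^m)(1) = \sum_S n! (#|G| - 1)^(n - #|S|) walks S m 1 / n^(2m)], and
    [#|W| * l2^2] is this quantity at [m = 2k], minus 1.

    By Fourier analysis [#|S|! * walks S m 1 = \sum_i chi_i(1)^2 t_i^m].  Let [l] be
    the size of a largest [B] whose symmetrizer does not kill [chi_i], [N = #|S|]
    and [j = N - l].  Maximality of [B] makes the transpositions joining [B] to
    [S :\: B] act by [-1] per point of [S :\: B], so
    [t_i = l^2 - 2j + t'] with [t'] an eigenvalue for [S :\: B]; induction gives
    [t_i <= N * l] and [t_i <= l^2 - 2j + j^2].  Clifford theory for [Sym B] in the
    stabilizer of [B] bounds the sum of the [chi_i(1)^2] of level [l] by
    ['C(N, j) * N ^_ j], and tensoring with the sign disposes of the negative
    eigenvalues.  For [k >= N ln N / 2 + c N] the level [j] terms are then at most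
    [exp(-4c) (4j)^(15j/16) / j!], up to constants, which is summable.
    A proper subset [S] with [i = n - #|S|] also carries
    [(#|S| / n)^(4k) <= exp(-4ki / n)], which absorbs [n^(2i) (#|G| - 1)^i] and
    leaves [exp(-4ci)]. *)

(** * Eigenfunctions of sums of transpositions *)

Section Symmetrization.
Variables (R : idomainType) (X : finType).
Implicit Types (f : {perm X} -> R) (A B C : {set X}) (s t : {perm X}).

Definition sym_sum B f s : R := \sum_(h in Sym B) f (h * s)%g.

(** Ordered pairs with the diagonal included: [#|A|] times the identity plus twice the sum of all
    transpositions of [A]. This is the walk step before normalization. *)
Definition transp_sum A f s : R :=
  \sum_(p in A) \sum_(q in A) f (tperm p q * s)%g.

Lemma mem_tperm_Sym B p q : p \in B -> q \in B -> tperm p q \in Sym B.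
Proof.
move=> Bp Bq; rewrite inE; apply/subsetP=> x; rewrite inE /=.
by case: tpermP => [->|->|] //; rewrite eqxx.
Qed.

Lemma SymS B C : B \subset C -> Sym B \subset Sym C.
Proof.
move=> sBC; apply/subsetP=> s; rewrite !inE => Bs; exact: subset_trans sBC.
Qed.

Lemma sym_sum_mul B f s h : h \in Sym B -> sym_sum B f (h * s)%g = sym_sum B f s.
Proof.
move=> Bh; rewrite /sym_sum [RHS](reindex_inj (mulIg h)) /=.
by apply: eq_big => [t|t _]; rewrite ?mulgA // (groupMr (G := Sym_group B)).
Qed.

Lemma sym_sum_small B f s : (#|B| <= 1)%N -> sym_sum B f s = f s.
Proof.
move=> B1; rewrite /sym_sum (big_pred1 1%g) ?mul1g // => h.
rewrite inE /=; apply/idP/eqP => [Bh|->]; first exact: perm_on_id B1.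
exact: perm_on1.
Qed.

(** Coset decomposition: the elements [h] of [Sym (p |: B)] with [h p = q] form the coset of [Sym B]
    represented by [tperm p q]. *)
Lemma sym_sum_setU1 B p f s : p \notin B ->
  sym_sum (p |: B) f s = \sum_(q in p |: B) sym_sum B f (tperm p q * s)%g.
Proof.
move=> Bp; rewrite /sym_sum.
rewrite (partition_big (fun h : {perm X} => h p) [in p |: B]) => [|h] /=; last first.
  by rewrite inE => Bh; rewrite (perm_closed _ Bh) setU11.
apply: eq_bigr => q Bq.
rewrite (reindex_inj (mulIg (tperm p q))) /=; apply: eq_big => [h|h _]; last first.
  by rewrite mulgA.
have tSym : tperm p q \in Sym (p |: B) by rewrite mem_tperm_Sym ?setU11.
rewrite groupMr // permM (canF_eq (tpermK p q)) tpermR !inE.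
apply/andP/idP=> [[h_on /eqP hp]|h_on].
  apply/subsetP=> x; rewrite inE => hx; have := subsetP h_on x.
  rewrite inE => /(_ hx) /setU1P[xp|//].
  by rewrite xp hp eqxx in hx.
split; last by rewrite (out_perm h_on).
by apply: subset_trans h_on _; apply: subsetUr.
Qed.

Lemma sym_sumC B C f s : [disjoint B & C] ->
  sym_sum B (sym_sum C f) s = sym_sum C (sym_sum B f) s.
Proof.
move=> dBC; rewrite /sym_sum exchange_big /=; apply: eq_bigr => h Ch.
apply: eq_bigr => k Bk; rewrite !mulgA; congr (f (_ * _)%g).
by rewrite !inE in Ch Bk; apply/esym/(perm_onC Bk Ch).
Qed.

(** The sum of transpositions is central in the group algebra of [Sym A]: conjugation by [h] only
    permutes the pairs [(p, q)]. *)
Lemma sym_sum_transp_sum A B f s : B \subset A ->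
  transp_sum A (sym_sum B f) s = sym_sum B (transp_sum A f) s.
Proof.
move=> sBA; rewrite /transp_sum /sym_sum.
under eq_bigr => p _ do rewrite exchange_big /=.
rewrite exchange_big /=; apply: eq_bigr => h Bh.
have Ah : h \in Sym A by apply: subsetP Bh; apply: SymS.
have hA x : (h x \in A) = (x \in A) by rewrite inE in Ah; apply: perm_closed.
rewrite [LHS](reindex_inj (@perm_inj _ h)) /=.
apply: eq_big => // p _; rewrite (reindex_inj (@perm_inj _ h)) /=.
apply: eq_big => // q _; rewrite !mulgA; congr (f (_ * _)%g).
by rewrite -tpermJ conjgE !mulgA mulgV mul1g.
Qed.

(* The symmetrizations over [p |: B], [p] outside [B], vanish: hence the mixed
   transpositions act by [-1] for each [p]. *)
Lemma transp_sum_setD A B f s : B \subset A ->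
  (forall p, p \in A :\: B -> forall s, sym_sum (p |: B) f s = 0) ->
  transp_sum A (sym_sum B f) s =
    ((#|B| ^ 2)%N%:Z - (#|A :\: B|.*2)%:Z)%:~R * sym_sum B f s
    + transp_sum (A :\: B) (sym_sum B f) s.
Proof.
move=> sBA f0; set g := sym_sum B f; set C := A :\: B.
have gB p : p \in C -> \sum_(q in B) g (tperm p q * s)%g = - g s.
  move=> Cp; have Bp : p \notin B by case/setDP: Cp.
  have := f0 p Cp s; rewrite sym_sum_setU1 // big_setU1 //= tperm1 mul1g => /eqP.
  by rewrite addrC addr_eq0 => /eqP.
have g_inv h : h \in Sym B -> g (h * s)%g = g s by apply: sym_sum_mul.
have splitA (F : X -> R) : \sum_(p in A) F p = \sum_(p in B) F p + \sum_(p in C) F p.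
  by rewrite (big_setID B) /= (setIidPr sBA).
rewrite /transp_sum splitA.
under eq_bigr do rewrite splitA.
under [X in _ + X]eq_bigr do rewrite splitA.
rewrite !big_split /= addrA; congr (_ + _).
have -> : \sum_(p in B) \sum_(q in B) g (tperm p q * s)%g = g s *+ #|B| ^ 2.
  under eq_bigr => p Bp.
    under eq_bigr => q Bq do rewrite g_inv ?mem_tperm_Sym //.
    rewrite sumr_const; over.
  by rewrite sumr_const -mulrnA mulnn.
have -> : \sum_(p in C) \sum_(q in B) g (tperm p q * s)%g = - g s *+ #|C|.
  by under eq_bigr => p Cp do rewrite gB //; rewrite sumr_const.
rewrite exchange_big /=.
have -> : \sum_(p in C) \sum_(q in B) g (tperm q p * s)%g = - g s *+ #|C|.
  by under eq_bigr => p Cp do (under eq_bigr do rewrite tpermC; rewrite gB //);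
     rewrite sumr_const.
rewrite -addrA -mulrnDr addnn rmorphB /= mulrBl -!pmulrn !mulr_natl.
by rewrite mulNrn.
Qed.

(** Strong induction on [#|A|]. [B] is a largest set whose symmetrizer does not kill [f], much like
    the first row of a Young diagram; the symmetrized function is then an eigenfunction for the
    smaller set [A :\: B], with a shifted eigenvalue. *)
Lemma transp_sum_eigenvalue A f (t : R) :
    (exists s, f s != 0) -> (forall s, transp_sum A f s = t * f s) ->
  exists (B : {set X}) (z : int),
    [/\ B \subset A /\ (exists s, sym_sum B f s != 0),
      (forall B' : {set X}, B' \subset A -> (#|B| < #|B'|)%N ->
        forall s, sym_sum B' f s = 0),
      t = z%:~R,
      z <= (#|A| * #|B|)%N%:Z
    & z <= (#|B| ^ 2)%N%:Z - (#|A :\: B|.*2)%:Z + (#|A :\: B| ^ 2)%N%:Z ].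
Proof.
have [m] := ubnP #|A|; elim: m => // m IHm in A f t *.
rewrite ltnS => Am [s0 f_s0] eig.
pose nz (B : {set X}) := (B \subset A) && [exists s, sym_sum B f s != 0].
have nz0 : nz set0.
  by rewrite /nz sub0set; apply/existsP; exists s0; rewrite sym_sum_small ?cards0.
case: (@arg_maxnP _ set0 nz (fun B : {set X} => #|B|) nz0) => B /andP[sBA /existsP[s1 Bs1]] maxB.
have vanish (B' : {set X}) :
    B' \subset A -> (#|B| < #|B'|)%N -> forall s, sym_sum B' f s = 0.
  move=> sB'A ltB s; apply/eqP; apply: contraTT ltB => nzB'; rewrite -leqNgt.
  by apply: maxB; rewrite /nz sB'A; apply/existsP; exists s.
have cardA : (#|A| = #|B| + #|A :\: B|)%N.
  by rewrite -(cardsID B A) (setIidPr sBA).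
have B_gt0 : A != set0 -> (0 < #|B|)%N.
  case/set0Pn=> x Ax; rewrite -(cards1 x); apply: maxB.
  rewrite /nz sub1set Ax; apply/existsP; exists s0.
  by rewrite sym_sum_small ?cards1.
set C := A :\: B in cardA *; set g := sym_sum B f.
have eigC s : transp_sum C g s
    = (t - ((#|B| ^ 2)%N%:Z - (#|C|.*2)%:Z)%:~R) * g s.
  rewrite mulrBl.
  have -> : t * g s = transp_sum A g s.
    rewrite sym_sum_transp_sum // /g /sym_sum mulr_sumr.
    by apply: eq_bigr => h _; rewrite eig.
  rewrite (@transp_sum_setD A B) // => [|p]; first by rewrite addrAC subrr add0r.
  case/setDP=> Ap Bp s'; apply: vanish; first by rewrite subUset sub1set Ap.
  by rewrite cardsU1 Bp.
have [C0|C_n0] := eqVneq C set0.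
  exists B, (#|B| ^ 2)%N%:Z; split; rewrite ?C0 ?cards0 ?subr0 ?addr0 //.
  - by split=> //; exists s1.
  - have /esym/eqP := eigC s1; rewrite C0 cards0 subr0 /transp_sum big_set0.
    by rewrite mulf_eq0 (negPf Bs1) orbF subr_eq0 => /eqP.
  - by rewrite cardA C0 cards0 addn0 mulnn.
  by rewrite -/C C0 cards0 subr0 addr0.
have C_lt_m : (#|C| < m)%N.
  have A_n0 : A != set0.
    by apply: contraNneq C_n0 => A0; rewrite /C A0 set0D.
  by have := B_gt0 A_n0; lia.
have [|B' [z [[sB'C [s2 B's2]] _ tz z_le1 z_le2]]] := IHm C g _ C_lt_m _ eigC.
  by exists s1.
have dB'B : [disjoint B' & B].
  by apply: disjointWl sB'C _; rewrite disjoints_subset subsetDr.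
(* Symmetrizers over disjoint sets commute, so a larger [B'] would already kill [f], by maximality
   of [B]. *)
have le_B'B : (#|B'| <= #|B|)%N.
  rewrite leqNgt; apply: contraNN B's2 => ltB; rewrite sym_sumC //.
  rewrite {1}/sym_sum big1 // => h _; apply: vanish => //.
  by apply: subset_trans sB'C _; rewrite subsetDl.
have le_B'C : (#|B'| <= #|C|)%N by apply: subset_leq_card.
exists B, (z + ((#|B| ^ 2)%N%:Z - (#|C|.*2)%:Z)); split=> //.
- by split=> //; exists s1.
- by rewrite rmorphD /= -tz subrK.
(* Both bounds start from [z <= #|C| * #|B'|]: the first uses [le_B'B], the second [le_B'C]. *)
- rewrite cardA; nia.
rewrite -/C; nia.
Qed.
End Symmetrization.
(** * Characters of the groups [Sym A] *)

Section SymCharacters.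
Variable X : finType.
Implicit Types (A B C : {set X}) (s t : {perm X}).

(** Schur's lemma: the sum of the [rG (tperm p q)] commutes with the irreducible representation,
    hence is a scalar matrix. *)
Lemma irr_transp_sum A (i : Iirr (Sym_group A)) :
  exists t : algC, forall s, transp_sum A 'chi_i s = t * 'chi_i s.
Proof.
set G := Sym_group A; pose rG := 'Chi_i.
have chiE s : s \in G -> 'chi_i s = \tr (rG s).
  by move=> Gs; rewrite -irrRepr cfunE Gs.
pose Z := \sum_(p in A) \sum_(q in A) rG (tperm p q).
have Gt p q : p \in A -> q \in A -> tperm p q \in G by exact: mem_tperm_Sym.
have /is_scalar_mxP[a Za] : is_scalar_mx Z.
  have absG : mx_absolutely_irreducible rG by exact/groupC/socle_irr.
  apply: (mx_abs_irr_cent_scalar absG).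
  apply/centgmxP=> g Gg; rewrite /Z mulmx_suml mulmx_sumr.
  have gA x : (g x \in A) = (x \in A) by rewrite inE in Gg; apply: perm_closed.
  rewrite [RHS](reindex_inj (@perm_inj _ g)) /=; apply: eq_big => // p Ap.
  rewrite mulmx_suml mulmx_sumr [RHS](reindex_inj (@perm_inj _ g)) /=.
  apply: eq_big => // q Aq.
  rewrite -!repr_mxM ?Gt ?gA //; congr (rG _).
  by rewrite -tpermJ conjgE !mulgA mulgV mul1g.
exists a => s; have [Gs|nGs] := boolP (s \in G); last first.
  rewrite (cfun0 _ nGs) mulr0 /transp_sum big1 // => p Ap.
  by rewrite big1 // => q Aq; rewrite cfun0 // groupMl // Gt.
have -> : transp_sum A 'chi_i s = \tr (Z *m rG s).
  rewrite /Z mulmx_suml raddf_sum; apply: eq_bigr => p Ap.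
  rewrite mulmx_suml raddf_sum; apply: eq_bigr => q Aq /=.
  by rewrite chiE ?groupM ?Gt // repr_mxM ?Gt.
by rewrite Za mul_scalar_mx mxtraceZ chiE.
Qed.

(* By the generalized orthogonality relation, the square norm of
   [s |-> \sum_(h in H) chi (h * s)] is proportional to [\sum_(h in H) chi h]. *)
Lemma irr_sum_translate (gT : finGroupType) (G H : {group gT}) (i : Iirr G) :
    H \subset G -> \sum_(h in H) 'chi_i h = 0 ->
  forall s : gT, \sum_(h in H) 'chi_i (h * s)%g = 0.
Proof.
move=> sHG chiH0 s; have HG h : h \in H -> h \in G by apply: subsetP.
pose F x := \sum_(h in H) 'chi_i (h * x)%g.
have [Gs|nGs] := boolP (s \in G); last first.
  by apply: big1 => h Hh; rewrite cfun0 // groupMl // HG.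
have /eqP : \sum_(x in G) `|F x| ^+ 2 = 0.
  have -> : \sum_(x in G) `|F x| ^+ 2 =
     \sum_(k in H) \sum_(h in H) \sum_(x in G) 'chi_i (x * (h * k^-1))%g * 'chi_i x^-1%g.
    under eq_bigr => x Gx.
      rewrite normCK /F mulr_suml.
      under eq_bigr do rewrite rmorph_sum mulr_sumr.
      rewrite exchange_big; over.
    rewrite exchange_big; apply: eq_bigr => k Hk /=.
    rewrite exchange_big; apply: eq_bigr => h Hh /=.
    have GkV : (k^-1)%g \in G by rewrite groupV HG.
    rewrite (reindex_inj (mulgI k^-1%g)) /=; apply: eq_big => x.
      by rewrite groupMl.
    rewrite groupMl // => Gx.
    rewrite mulKVg -char_inv ?irr_char //; congr (_ * _).
    rewrite mulgA -(cfunJ 'chi_i (x * (h * k^-1))%g (y := x)) //.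
    by rewrite conjgE !mulgA mulVg mul1g.
  rewrite big1 // => k Hk; under eq_bigr => h Hh.
    have := generalized_orthogonality_relation (h * k^-1)%g i i.
    rewrite eqxx mul1r => /(canRL (mulKf _)) -> //; last by rewrite invr_neq0 ?neq0CG.
    over.
  rewrite -mulr_sumr -mulr_suml (reindex_inj (mulIg k)) /=.
  under eq_bigl do rewrite groupMr //.
  by under eq_bigr do rewrite mulgK; rewrite chiH0 mul0r mulr0.
rewrite psumr_eq0 => [|x _]; last by rewrite exprn_ge0.
by move=> /allP/(_ s (mem_index_enum _)); rewrite Gs expf_eq0 /= normr_eq0 => /eqP.
Qed.

(** Induction on [#|B :\: C|]: swap a point of [B :\: C] with one of [C :\: B]. *)
Lemma perm_on_onto A B C : B \subset A -> C \subset A -> #|B| = #|C| ->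
  exists2 g, g \in Sym A & forall x, (g x \in C) = (x \in B).
Proof.
move=> sBA sCA; have [m] := ubnP #|B :\: C|.
elim: m => // m IHm in B sBA *; rewrite ltnS => Bm eBC.
have [BC|BnC] := boolP (B \subset C).
  exists 1%g; first exact: group1 (Sym_group A).
  by move=> x; rewrite perm1; have /eqP-> : B == C by rewrite eqEcard BC eBC /=.
have [x Bx Cx] := subsetPn BnC.
have [y Cy By] : exists2 y, y \in C & y \notin B.
  apply/subsetPn; apply: contra BnC => sCB.
  by have /eqP-> : C == B by rewrite eqEcard sCB eBC /=.
pose B1 := tperm x y @: B.
have B1E z : (tperm x y z \in B1) = (z \in B) by rewrite mem_imset //; exact: perm_inj.
have tA : tperm x y \in Sym A.
  by apply: mem_tperm_Sym; [apply: (subsetP sBA) | apply: (subsetP sCA)].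
have [|||g Ag gP] := IHm B1.
- apply/subsetP=> z; rewrite -[z](tpermK x y) B1E => /(subsetP sBA) Az.
  by rewrite inE in tA; rewrite perm_closed.
- apply: leq_trans Bm; rewrite (cardsD1 x (B :\: C)) inE Bx Cx add1n ltnS.
  apply: subset_leq_card; apply/subsetP=> z; rewrite !inE => /andP[nCz].
  rewrite -[z in z \in B1](tpermK x y) B1E; case: tpermP => [zx|zy|]; rewrite ?(negPf By) //.
    by rewrite zy Cy in nCz.
  by move=> /eqP zx _ ->; rewrite nCz zx.
- by rewrite card_imset //; exact: perm_inj.
exists (tperm x y * g)%g; first by rewrite (groupM (G := Sym_group A)).
by move=> z; rewrite permM gP B1E.
Qed.

(** [Sym B] and [Sym C] are conjugate in [Sym A], so whether a symmetrizer kills a character depends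
    only on the size of the set. *)
Lemma irr_sum_Sym A B C (i : Iirr (Sym_group A)) :
    B \subset A -> C \subset A -> #|B| = #|C| ->
  \sum_(h in Sym B) 'chi_i h = \sum_(h in Sym C) 'chi_i h.
Proof.
move=> sBA sCA eBC; have [g Ag gP] := perm_on_onto sBA sCA eBC.
rewrite [RHS](reindex_inj (conjg_inj g)) /=; apply: eq_big => [h|h _]; last first.
  by rewrite cfunJ.
rewrite !inE; apply/subsetP/subsetP => hP x; rewrite inE.
  rewrite -[x](permKV g) permJ (inj_eq perm_inj) gP => hx.
  by apply: hP; rewrite inE.
by move=> hx; rewrite -gP; apply: hP; rewrite inE permJ (inj_eq perm_inj).
Qed.

(** Some constituent [chi_j] of the restriction to [K] has an [H]-fixed vector. Since [H] is normal
    in [K], it lies in the kernel of [chi_j], so the degree of [chi_j] is at most the multiplicity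
    on the right. By Frobenius reciprocity [chi_i] occurs in the character induced from [chi_j]. *)
Lemma irr1_le_fixed (gT : finGroupType) (G K H : {group gT}) (i : Iirr G) :
    K \subset G -> (H <| K)%g -> '['Res[H] 'chi_i, 1] != 0 ->
  'chi_i 1%g <= #|G : K|%g%:R * '['Res[H] 'chi_i, 1].
Proof.
move=> sKG nHK; have sHK := normal_sub nHK.
rewrite -irr0 -(cfResRes _ sHK sKG) => fix_n0.
have Nres : 'Res[K] 'chi_i \is a character by rewrite cfRes_char ?irr_char.
have [j jP j0] : exists2 j, j \in irr_constt ('Res[K] 'chi_i)
    & '['Res[H] 'chi[K]_j, 'chi_0] != 0.
  apply/exists_inP; apply: contraNT fix_n0 => /exists_inPn fix0.
  rewrite {1}['Res[K] _]cfun_sum_constt linear_sum cfdot_suml big1 // => j jP.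
  by rewrite linearZ cfdotZl; have /negPn/eqP-> := fix0 j jP; rewrite mulr0.
have jdim : 'chi_j 1%g = '['Res[H] 'chi[K]_j, 'chi_0].
  rewrite cfRes_sub_ker ?constt0_Res_cfker //.
  by rewrite cfdotZl irr0 cfnorm1 mulr1.
apply: le_trans (_ : #|G : K|%g%:R * 'chi_j 1%g <= _).
  rewrite -cfInd1 //; apply: char1_ge_constt; last by rewrite constt_Ind_Res.
  by rewrite cfInd_char ?irr_char.
by rewrite ler_wpM2l ?ler0n // jdim cfdot_Res_ge_constt.
Qed.

(** Degree of the permutation character on the cosets of [H], decomposed by Frobenius
    reciprocity. *)
Lemma sum_irr1_fixed (gT : finGroupType) (G H : {group gT}) : H \subset G ->
  \sum_(i : Iirr G) 'chi_i 1%g * '['Res[H] 'chi_i, 1] = #|G : H|%g%:R.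
Proof.
move=> sHG; have <- : 'Ind[G, H] 1 1%g = #|G : H|%g%:R.
  by rewrite cfInd1 // cfun11 mulr1.
rewrite ['Ind[G] 1]cfun_sum_cfdot sum_cfunE; apply: eq_bigr => i _.
rewrite cfunE mulrC; congr (_ * _); rewrite cfdot_Res_l cfdotC conj_natr //.
by rewrite Cnat_cfdot_char ?cfInd_char ?irr_char ?cfun1_char.
Qed.

Lemma irr_sum_eq0 (gT : finGroupType) (G H : {group gT}) (i : Iirr G) :
  H \subset G -> (\sum_(h in H) 'chi_i h == 0) = ('['Res[H] 'chi_i, 1] == 0).
Proof.
move=> sHG; rewrite cfdotE mulf_eq0 invr_eq0 (negPf (neq0CG H)) /=.
congr (_ == _); apply: eq_bigr => h Hh.
by rewrite cfResE // cfun1E Hh conjC1 mulr1.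
Qed.

Lemma cfdot_Res_cfun1_ge0 (gT : finGroupType) (G H : {group gT}) (i : Iirr G) :
  0 <= '['Res[H] 'chi_i, 1].
Proof.
by apply: natr_ge0; rewrite Cnat_cfdot_char ?cfRes_char ?irr_char ?cfun1_char.
Qed.

(** One factor of each squared degree is bounded by [irr1_le_fixed], with [K] the setwise stabilizer
    of [B]; the other factor, weighted by the multiplicities, sums to the index of [Sym B]. *)
Lemma sum_irr1_sqr_Sym_le A B : B \subset A ->
  \sum_(i : Iirr (Sym_group A) | \sum_(h in Sym B) 'chi_i h != 0) 'chi_i 1%g ^+ 2
    <= ('C(#|A|, #|B|) * #|A| ^_ (#|A| - #|B|))%N%:R.
Proof.
move=> sBA; pose G := Sym_group A; pose H := Sym_group B.
have sHG : H \subset G by apply: SymS.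
pose K := [group of 'N_G(B | 'P)%g].
have sKG : K \subset G by rewrite subsetIl.
have sHK : H \subset K.
  rewrite subsetI sHG; apply/subsetP=> h; rewrite !inE => Bh; apply/subsetP=> x Bx.
  by rewrite inE /= apermE perm_closed.
have nHK : (H <| K)%g.
  rewrite /normal sHK; apply/subsetP=> g /setIP[_ /astabsP gB]; rewrite inE.
  apply/subsetP=> _ /imsetP[h Hh ->]; rewrite inE; apply/subsetP=> x; rewrite inE.
  rewrite -[x](permKV g) permJ (inj_eq perm_inj) -apermE gB => hx.
  by rewrite inE in Hh; apply: (subsetP Hh); rewrite inE.
(* The index is the size of the orbit of [B], which consists of subsets of [A] of size [#|B|]. *)
have idxK : (#|G : K|%g <= 'C(#|A|, #|B|))%N.
  rewrite /K /= -astab1_set -card_orbit -cards_draws; apply: subset_leq_card.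
  apply/subsetP=> _ /orbitP[g Gg <-]; rewrite inE /=.
  rewrite /setact card_imset ?eqxx ?andbT; last exact: act_inj.
  apply/subsetP=> _ /imsetP[x Bx ->]; rewrite /= apermE.
  by rewrite inE in Gg; rewrite perm_closed ?(subsetP sBA).
have idxH : #|G : H|%g = (#|A| ^_ (#|A| - #|B|))%N.
  rewrite -divgS // !card_Sym ffact_factd ?leq_subr // subKn // subset_leq_card //.
rewrite natrM -idxH -sum_irr1_fixed // mulr_sumr big_mkcond /=.
apply: ler_sum => i _; rewrite irr_sum_eq0 //; case: ifPn => [nz|_]; last first.
  apply: mulr_ge0; first exact: ler0n.
  by apply: mulr_ge0; [apply/char1_ge0/irr_char | apply: cfdot_Res_cfun1_ge0].
rewrite expr2 mulrCA; apply: ler_wpM2l; first exact/char1_ge0/irr_char.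
apply: le_trans (irr1_le_fixed sKG nHK nz) _.
by rewrite ler_wpM2r ?cfdot_Res_cfun1_ge0 ?ler_nat.
Qed.

End SymCharacters.

(** * Counting walks in [Sym A] through its characters *)

Section Walks.
Variable X : finType.
Implicit Types (A B C : {set X}) (s t : {perm X}).

(** The number of ways to write [s] as a product of [m] factors [tperm p q], over ordered pairs of
    points of [A], trivial factors [p = q] included. *)
Fixpoint walks A m s : nat :=
  if m is m'.+1 then \sum_(p in A) \sum_(q in A) walks A m' (tperm p q * s)%g
  else s == 1%g.

(** At [m = 0] this is the decomposition of the regular character; every further step multiplies
    each irreducible character by its eigenvalue. *)
Lemma walks_irr A (t : Iirr (Sym_group A) -> algC) :
    (forall i s, transp_sum A 'chi_i s = t i * 'chi_i s) ->
  forall m s, (#|A|`! * walks A m s)%N%:R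
    = \sum_i 'chi[Sym_group A]_i 1%g * t i ^+ m * 'chi_i s.
Proof.
move=> tP; elim=> [|m IHm] s /=.
  under eq_bigr do rewrite expr0 mulr1.
  rewrite natrM -card_Sym mulr_natr -cfRegE cfReg_sum sum_cfunE.
  by apply: eq_bigr => i _; rewrite cfunE.
rewrite natrM natr_sum mulr_sumr.
under [LHS]eq_bigr => p _.
  rewrite natr_sum mulr_sumr; under eq_bigr => q _ do rewrite -natrM IHm.
  rewrite exchange_big; over.
rewrite exchange_big; apply: eq_bigr => i _ /=.
rewrite exprSr -!mulrA -tP !mulr_sumr; apply: eq_bigr => p _.
by rewrite !mulr_sumr; apply: eq_bigr => q _; rewrite mulrA.
Qed.

Lemma irr_sign_twist A (i : Iirr (Sym_group A)) :
  exists j : Iirr (Sym_group A), forall s, 'chi_j s = (-1) ^+ (s : bool) * 'chi_i s.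
Proof.
set G := Sym_group A.
pose sg s : 'M[algC]_1 := ((-1) ^+ (s : bool))%:M.
have sg_repr : mx_repr G sg.
  split=> [|s t _ _]; first by rewrite /sg odd_perm1.
  by rewrite /sg odd_permM signr_addb -scalar_mxM.
pose xi := cfRepr (MxRepresentation sg_repr).
have xi_lin : xi \is a linear_char by rewrite qualifE/= cfRepr_char cfRepr1 eqxx.
have xi_irr : xi * 'chi_i \in irr G by rewrite mul_lin_irr ?mem_irr.
exists (cfIirr (xi * 'chi_i)) => s; rewrite cfIirrE // cfunE.
have [Gs|nGs] := boolP (s \in G); last by rewrite (cfun0 'chi_i) ?mulr0.
by rewrite cfunE Gs /= mxtrace_scalar mulr1n.
Qed.

(** The sign flips every term except the [#|A|] diagonal ones, whence [t] becomes [2 * #|A| - t]. *)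
Lemma transp_sum_sign (R : idomainType) A (f g : {perm X} -> R) (t : R) :
    (forall s, transp_sum A f s = t * f s) ->
    (forall s, g s = (-1) ^+ (s : bool) * f s) ->
  forall s, transp_sum A g s = (#|A|.*2%:R - t) * g s.
Proof.
move=> fP gE s; pose e : R := (-1) ^+ (s : bool).
have -> : transp_sum A g s = \sum_(p in A) (f s *+ 2 - \sum_(q in A) f (tperm p q * s)%g) * e.
  apply: eq_bigr => p Ap; rewrite (bigD1 p) //= [in RHS](bigD1 p) //=.
  rewrite tperm1 mul1g gE mulr2n opprD addrACA subrr add0r mulrDl [f s * e]mulrC.
  congr (_ + _); rewrite -sumrN mulr_suml; apply: eq_bigr => q /andP[_ qp].
  by rewrite gE odd_permM odd_tperm eq_sym qp signr_addb mulN1r mulrC mulrN mulNr.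
rewrite -mulr_suml sumrB sumr_const -/(transp_sum A f s) fP gE.
by rewrite -mulrnA mul2n -[f s *+ _]mulr_natl -mulrBl -mulrA [f s * e]mulrC.
Qed.

(** A nontrivial irreducible character is orthogonal to the trivial one, so its level is below
    [#|A|]. *)
Lemma irr_eq0_level A (i : Iirr (Sym_group A)) (s : {perm X}) :
  i != 0 -> sym_sum A 'chi_i s = 0.
Proof.
move=> i_n0; apply: (@irr_sum_translate _ _ (Sym_group A) i) => //.
apply/eqP; rewrite irr_sum_eq0 // cfRes_id -irr0 cfdot_irr.
by rewrite (negPf i_n0).
Qed.

Lemma walks_spectrum A : let N := #|A| in
  exists (I : finType) (i0 : I) (d l : I -> nat) (z : I -> int) (tw : I -> I),
  [/\ forall m, (N`! * walks A m 1%g)%N%:Z = \sum_i (d i ^ 2)%N%:Z * z i ^+ m,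
     d i0 = 1%N /\ z i0 = (N ^ 2)%N%:Z,
     injective tw /\ (forall i, d (tw i) = d i /\ z (tw i) = N.*2%:Z - z i),
     (forall i, i != i0 ->
       [/\ (l i < N)%N, z i <= (N * l i)%N%:Z
         & z i <= (l i ^ 2)%N%:Z - (N - l i).*2%:Z + ((N - l i) ^ 2)%N%:Z])
   & forall l0, (\sum_(i | l i == l0) d i ^ 2 <= 'C(N, l0) * N ^_ (N - l0))%N ].
Proof.
move=> N; pose G := Sym_group A.
have [t tP] := fin_all_exists (@irr_transp_sum X A).
pose d (i : Iirr G) := Num.truncn ('chi_i 1%g).
have dE i : 'chi_i 1%g = (d i)%:R by rewrite truncnK // Cnat_irr1.
have chi1_n0 i : 'chi[G]_i 1%g != 0 by apply: irr1_neq0.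
have eig i := transp_sum_eigenvalue (ex_intro _ 1%g (chi1_n0 i)) (tP i).
have [B BP] := fin_all_exists eig; have [z zP] := fin_all_exists BP.
have [tw twP] := fin_all_exists (@irr_sign_twist A).
have tE i : t i = (z i)%:~R by have [] := zP i.
have zE i c : (forall s, transp_sum A 'chi_i s = c%:~R * 'chi_i s) -> z i = c.
  move=> /(_ 1%g); rewrite tP tE => /(mulIf (chi1_n0 i)) /eqP.
  by rewrite eqr_int => /eqP.
have cardB i : #|A :\: B i| = (N - #|B i|)%N.
  by have [[sBA _] _ _ _ _] := zP i; rewrite cardsD (setIidPr sBA).
exists (Iirr G), 0, d, (fun i => #|B i|), z, tw; split.
- move=> m; apply/eqP; rewrite -(eqr_int algC) -pmulrn (walks_irr tP).
  rewrite rmorph_sum; apply/eqP; apply: eq_bigr => i _ /=.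
  rewrite rmorphM rmorphXn /= tE dE -pmulrn natrX expr2.
  by rewrite mulrAC.
- split; first by apply/eqP; rewrite -(eqr_nat algC) -dE irr0 cfun11.
  apply: zE => s; rewrite irr0.
  rewrite /transp_sum; under eq_bigr => p Ap.
    under eq_bigr => q Aq.
      rewrite cfun1E groupMl ?(mem_tperm_Sym Ap Aq) // -cfun1E.
      over.
    rewrite sumr_const; over.
  by rewrite sumr_const -mulrnA mulnn -pmulrn mulr_natl.
- split=> [i j eq_tw|i].
    apply: irr_inj; apply/cfunP=> s.
    have := twP i s; rewrite eq_tw twP => /(mulfI _) -> //.
    by rewrite signr_eq0.
  split; first by apply/eqP; rewrite -(eqr_nat algC) -!dE twP odd_perm1 mul1r.
  apply: zE => s; rewrite (transp_sum_sign (tP i) (twP i)) tE.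
  by rewrite rmorphB.
- move=> i i_n0; have [[sBA [s Bs]] _ _ z1 z2] := zP i; rewrite cardB in z2.
  split=> //; rewrite ltn_neqAle subset_leq_card // andbT.
  apply: contraNneq Bs => eBA; have -> : B i = A.
    by apply/eqP; rewrite eqEcard sBA eBA /=.
  by rewrite irr_eq0_level.
(* The set [B i] of one character of level [l0] serves for all of them, by [irr_sum_Sym]. *)
move=> l0; have [i /eqP il0|no_i] := pickP (fun i => #|B i| == l0); last first.
  by rewrite big_pred0.
rewrite -(ler_nat algC) -il0; have [[sBA _] _ _ _ _] := zP i.
apply: le_trans (sum_irr1_sqr_Sym_le sBA); rewrite natr_sum.
rewrite [leRHS]big_mkcond [leLHS]big_mkcond /=; apply: ler_sum => j _.
case: eqP => [eBj|_]; last by case: ifP => // _; rewrite dE -natrX ler0n.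
have [[sBjA [s Bjs]] _ _ _ _] := zP j.
rewrite (irr_sum_Sym _ sBA sBjA) //.
rewrite ifT ?dE ?natrX //; apply: contraNneq Bjs => chi0.
by apply/eqP/(@irr_sum_translate _ _ (Sym_group (B j)) j); rewrite ?SymS.
Qed.

End Walks.
(** * The random transposition walk *)

Section Estimates.
Variable R : realType.
Implicit Types (x y c : R) (N j k m n : nat).

(** The gain of [1 / 16] over [1 - x <= expR (- x)] produces the exponent [15 / 16 < 1] that makes
    the level terms summable. *)
Lemma subr_le_expR x : 4^-1 <= x <= 1 -> 1 - x <= expR (- (17 / 16 * x)).
Proof.
move=> x41.
have -> : - (17 / 16 * x) = - (x / 2) + (- (x / 2) + - (x / 16)) by lra.
rewrite !expRD.
have e1 := expR_ge1Dx (- (x / 2)); have e2 := expR_ge1Dx (- (x / 16)).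
apply: (@le_trans _ _ ((1 - x / 2) * ((1 - x / 2) * (1 - x / 16)))); first by nra.
by rewrite !ler_pM //; nra.
Qed.

Lemma exprn_fact_le_expR x n : 0 <= x -> x ^+ n <= n`!%:R * expR x.
Proof.
case: n => [|n] x_ge0; first by rewrite expr0 mul1r -expR0 ler_expR.
rewrite mulrC -ler_pdivrMr ?ltr0n ?fact_gt0 //.
by apply: le_trans (expR_ge1Dxn n x_ge0); rewrite lerDr ler01.
Qed.

Lemma expR_ln_natM n m : (0 < n)%N -> expR (m%:R * ln n%:R) = n%:R ^+ m :> R.
Proof. by move=> n_gt0; rewrite expRM_natl lnK // posrE ltr0n. Qed.

Lemma ln4_ge1 : 1 <= ln 4 :> R.
Proof.
have ln2 : 2^-1 <= ln 2 :> R.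
  have := @le_ln1Dx R (- 2^-1) _; have -> : 1 + - 2^-1 = 2^-1 :> R by lra.
  rewrite lnV ?posrE //; lra.
have -> : 4 = 2 ^+ 2 :> R by ring.
rewrite lnXn // mulr2n; lra.
Qed.

(** [ln x / x] decreases once [ln x >= 1], which holds from 4 on; the proof uses the tangent bound
    on [ln (n / m)]. *)
Lemma ln_ratio_le m n : (4 <= m <= n)%N -> m%:R * ln n%:R <= n%:R * ln m%:R :> R.
Proof.
move=> /andP[m4 mn]; set x : R := m%:R; set y : R := n%:R.
have x4 : 4 <= x by rewrite ler_nat.
have xy : x <= y by rewrite ler_nat.
have lnx : 1 <= ln x by apply: le_trans ln4_ge1 _; rewrite ler_ln ?posrE //; lra.
have : ln (y / x) <= y / x - 1.
  have -> : y / x = 1 + (y / x - 1) by ring.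
  have -> : 1 + (y / x - 1) - 1 = y / x - 1 by ring.
  by apply: le_ln1Dx; rewrite ltrBDr addNr divr_gt0; lra.
rewrite ln_div ?posrE; try lra.
rewrite lerBlDr => lny.
have : x * ln y <= x * (y / x - 1 + ln x) by rewrite ler_wpM2l //; lra.
have -> : x * (y / x - 1 + ln x) = y - x + x * ln x.
  by field; lra.
nra.
Qed.

(* The two bounds on [t] are the eigenvalue bounds for a level [j] eigenfunction;
   the first is used for small [j], the second for large [j]. *)
Lemma level_term_le N j k c t : (1 <= j <= N)%N -> 0 <= c -> 0 <= t ->
    1 / 2 * N%:R * ln N%:R + c * N%:R <= k%:R ->
    t <= expR (- (2 * j%:R * (N%:R - j%:R + 1) / N%:R ^+ 2)) ->
    t <= 1 - j%:R / N%:R ->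
  N%:R ^+ (2 * j) * t ^+ (2 * k) <=
    expR (- 4 * c) * expR (15 / 16 * j%:R * ln (4 * j)%:R).
Proof.
move=> /andP[j1 jN] c0 t0 hk ta tb.
have N0 : (0 < N)%N by lia.
rewrite -expR_ln_natM // -expRD natrM.
set n : R := N%:R in hk ta tb *; set L := ln n in hk *; set J : R := j%:R in ta tb *.
have n1 : 1 <= n by rewrite ler1n.
have J1 : 1 <= J by rewrite ler1n.
have Jn : J <= n by rewrite ler_nat.
have L0 : 0 <= L by apply: ln_ge0.
have l4j0 : 0 <= ln (4 * j)%:R :> R by apply: ln_ge0; rewrite ler1n; lia.
have tE u : t <= expR (- u) -> t ^+ (2 * k) <= expR (- (2 * k%:R * u)).
  move=> tu; rewrite -mulrN -natrM expRM_natl.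
  by rewrite lerXn2r ?nnegrE ?expR_ge0.
suff [u tu hu] : exists2 u, t <= expR (- u) &
    2 * J * L - 2 * k%:R * u <= - 4 * c + 15 / 16 * J * ln (4 * j)%:R.
  rewrite expRD in hu *.
  apply: (@le_trans _ _ (expR (2 * J * L) * expR (- (2 * k%:R * u)))).
    by rewrite ler_wpM2l ?expR_ge0 ?tE.
  by rewrite -!expRD ler_expR.
(* The case [j = 1] is always put on the first side, where its loss [J - v] is 0: the other side
   needs [J >= 2] to have [17 / 8 * J >= 4] in front of [c]. *)
have [small|big] := boolP ((4 * j <= N) || (j == 1))%N.
  exists (2 * J * (n - J + 1) / n ^+ 2) => //.
  pose v := J * (n - J + 1) / n.
  have vn : v * n = J * (n - J + 1) by rewrite /v; field; lra.
  have v1 : 1 <= v by rewrite /v ler_pdivlMr; nra.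
  have -> : 2 * k%:R * (2 * J * (n - J + 1) / n ^+ 2) = 4 * v * (k%:R / n).
    by rewrite /v; field; lra.
  have kn : L / 2 + c <= k%:R / n by rewrite ler_pdivlMr; lra.
  have : 4 * v * (L / 2 + c) <= 4 * v * (k%:R / n) by rewrite ler_wpM2l //; lra.
  have cv : c <= c * v by nra.
  (* Here [J - v = J * (J - 1) / n], and [ln_ratio_le] trades [L / n] for [ln (4 * j) / (4 * j)]. *)
  suff : L * (J - v) <= J * ln (4 * j)%:R / 4 by nra.
  have [j4|/eqP j1'] := orP small; last first.
    have J1' : J = 1 by rewrite /J j1'.
    have -> : J - v = 0 by rewrite /v J1'; field; lra.
    by rewrite mulr0; nra.
  have := @ln_ratio_le (4 * j) N; rewrite j4 andbT => /(_ _).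
  have /[swap] /[apply] : (4 <= 4 * j)%N by rewrite leq_pmulr.
  rewrite natrM -/J -/n -/L => hL.
  rewrite -(ler_pM2r (_ : 0 < n)); last lra.
  have -> : L * (J - v) * n = L * J * (J - 1) by rewrite -mulrA mulrBl vn; ring.
  nra.
rewrite negb_or -ltnNge in big; have [N4 j_n1] := andP big.
have J2 : 2 <= J by rewrite ler_nat ltn_neqAle eq_sym j_n1.
(* The terms in [L] add up to [2 * J * L - 17 / 16 * J * L = 15 / 16 * J * L], and [L <= ln (4 * j)]
   on this side. *)
exists (17 / 16 * (J / n)).
  apply: le_trans tb _; apply: subr_le_expR.
  rewrite ler_pdivrMr ?ler_pdivlMr; try lra.
  have : n <= 4 * J by rewrite -natrM ler_nat ltnW.
  by lra.
have Ll : L <= ln (4 * j)%:R by rewrite ler_ln ?posrE ?ltr0n ?ler_nat ?muln_gt0 // ltnW.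
have kn : L / 2 + c <= k%:R / n by rewrite ler_pdivlMr; lra.
have -> : 2 * k%:R * (17 / 16 * (J / n)) = 17 / 8 * J * (k%:R / n) by field; lra.
have : 17 / 8 * J * (L / 2 + c) <= 17 / 8 * J * (k%:R / n) by rewrite ler_wpM2l //; lra.
nra.
Qed.

(** Sixteenth powers clear the fraction. Of the 16 factors [j!], fifteen absorb [j ^ j] through
    [j ^ j <= j! * e ^ j]; the last absorbs [K ^ j], where [K] gathers all geometric factors. *)
Lemma level_weight_le : exists2 C : R, 0 < C & forall j, (0 < j)%N ->
  expR (15 / 16 * j%:R * ln (4 * j)%:R) / j`!%:R <= C / 2 ^+ j.
Proof.
pose K : R := 2 ^+ 16 * 4 ^+ 15 * expR 1 ^+ 15.
have K0 : 0 <= K by rewrite !mulr_ge0 ?exprn_ge0 ?expR_ge0.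
exists (expR (K / 16)); first exact: expR_gt0.
move=> j j0; have f0 : 0 < j`!%:R :> R by rewrite ltr0n fact_gt0.
have C0 : 0 <= expR (K / 16) / 2 ^+ j by rewrite divr_ge0 ?expR_ge0 ?exprn_ge0.
rewrite -(@ler_pXn2r _ 16) ?nnegrE ?divr_ge0 ?expR_ge0 ?(ltW f0) //.
rewrite !exprMn !exprVn -!expRM_natl.
have -> : 16 * (K / 16) = K by field.
have -> : 16 * (15 / 16 * j%:R * ln (4 * j)%:R) = (15 * j)%N%:R * ln (4 * j)%:R :> R.
  by rewrite natrM; field.
rewrite expR_ln_natM ?muln_gt0 // natrM exprMn.
have -> : j%:R ^+ (15 * j) = (j%:R ^+ j) ^+ 15 :> R by rewrite -exprM mulnC.
have jj : j%:R ^+ j <= j`!%:R * expR 1 ^+ j :> R.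
  by have := @exprn_fact_le_expR j%:R j (ler0n _ _); rewrite -{2}(mulr1 j%:R) expRM_natl.
have KK : K ^+ j <= j`!%:R * expR K by apply: exprn_fact_le_expR.
have jj15 : (j%:R ^+ j) ^+ 15 <= (j`!%:R * expR 1 ^+ j) ^+ 15 :> R.
  by rewrite lerXn2r ?nnegrE ?exprn_ge0 ?ler0n // mulr_ge0 ?exprn_ge0 ?expR_ge0 ?ltW.
have e2 : 0 < (2 ^+ j) ^+ 16 :> R by rewrite !exprn_gt0.
rewrite ler_pdivlMr // mulrAC ler_pdivrMr ?exprn_gt0 //.
apply: (@le_trans _ _ (4 ^+ (15 * j) * (j`!%:R * expR 1 ^+ j) ^+ 15 * (2 ^+ j) ^+ 16)).
  by rewrite ler_pM2r // ler_wpM2l ?exprn_ge0.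
have -> : 4 ^+ (15 * j) * (j`!%:R * expR 1 ^+ j) ^+ 15 * (2 ^+ j) ^+ 16
    = K ^+ j * j`!%:R ^+ 15 :> R.
  have KE (a b e : R) : (a * b * e) ^+ j = a ^+ j * b ^+ j * e ^+ j by rewrite !exprMn.
  have fE (a b : R) : (a * b) ^+ 15 = a ^+ 15 * b ^+ 15 by rewrite exprMn.
  by rewrite /K KE fE -!exprM ![(_ * j)%N]mulnC; ring.
  have -> : expR K * j`!%:R ^+ 16 = j`!%:R * expR K * j`!%:R ^+ 15 by ring.
  by rewrite ler_wpM2r ?exprn_ge0 ?(ltW f0).
by rewrite exprn_ge0.
Qed.

Lemma sum_geometric_half n : \sum_(l < n) (2 ^+ (n - l))^-1 <= 1 :> R.
Proof.
have -> : \sum_(l < n) (2 ^+ (n - l))^-1 = 1 - (2 ^+ n)^-1 :> R.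
  elim: n => [|n IHn]; first by rewrite big_ord0 expr0 invr1 subrr.
  rewrite big_ord_recl subn0; under eq_bigr do rewrite subSS.
  by rewrite IHn exprS invfM; lra.
by rewrite lerBlDr lerDl invr_ge0 exprn_ge0.
Qed.

End Estimates.

Lemma ffact_le_expn n m : (n ^_ m <= n ^ m)%N.
Proof.
by elim: m => // m IHm; rewrite ffactnSr expnSr leq_mul ?leq_subr.
Qed.

(** * Returns of the random transposition walk *)

Section RandomTranspositions.
Variable R : realType.

Lemma binomial_ffact_le N j :
  ('C(N, j) * N ^_ j)%N%:R <= N%:R ^+ (2 * j) / j`!%:R :> R.
Proof.
have f0 : 0 < j`!%:R :> R by rewrite ltr0n fact_gt0.
rewrite ler_pdivlMr // -natrM -natrX ler_nat mulnAC bin_ffact mulnn mulnC expnM.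
by rewrite leq_exp2r // ffact_le_expn.
Qed.

Lemma walks_le : exists2 C : R, 0 < C &
  forall (X : finType) (A : {set X}) (k : nat) (c : R),
    (0 < #|A|)%N -> 0 <= c ->
    1 / 2 * #|A|%:R * ln #|A|%:R + c * #|A|%:R <= k%:R ->
  (#|A|`! * walks A (2 * k) 1%g)%N%:R / (#|A|%:R ^+ 2) ^+ (2 * k)
    <= 1 + C * expR (- 4 * c).
Proof.
have [C C0 CP] := level_weight_le R.
(* The [1] pays for the sign character, [2 * C] for the positive and negative parts of the rest. *)
exists (1 + 2 * C); first by rewrite addr_gt0 ?mulr_gt0.
move=> X A k c; set N := #|A| => N0 c0 hk.
have [I [i0 [d [l [z [tw [sumE [di0 zi0] [tw_inj twP] lP cntP]]]]]]] := walks_spectrum A.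
rewrite -/N in sumE di0 zi0 twP lP cntP.
have n0 : 0 < N%:R :> R by rewrite ltr0n.
pose w i : R := (z i)%:~R / N%:R ^+ 2.
pose D i : R := (d i ^ 2)%N%:R.
have D0 i : 0 <= D i by apply: ler0n.
have -> : (N`! * walks A (2 * k) 1%g)%N%:R / (N%:R ^+ 2) ^+ (2 * k)
    = \sum_i D i * w i ^+ (2 * k).
  have -> : (N`! * walks A (2 * k) 1%g)%N%:R =
      ((N`! * walks A (2 * k) 1%g)%N%:Z)%:~R :> R by rewrite -pmulrn.
  rewrite sumE rmorph_sum mulr_suml; apply: eq_bigr => i _ /=.
  by rewrite rmorphM rmorphXn /= -pmulrn /w expr_div_n mulrA.
have max0_ge0 (x : R) : 0 <= Num.max x 0 by rewrite le_max lexx orbT.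
(* Nonnegative eigenvalues are kept in [pw]; a negative [w i] is charged to its twist through
   [- w i = w (tw i) - 2 / N]. *)
pose pw i := Num.max (w i) 0 ^+ (2 * k).
pose mw i := Num.max (w i - 2 / N%:R) 0 ^+ (2 * k).
have pw0 i : 0 <= pw i by apply: exprn_ge0.
have split_w i : w i ^+ (2 * k) <= pw i + mw (tw i).
  have mw0 : 0 <= mw (tw i) by apply: exprn_ge0.
  have [wi|wi] := leP 0 (w i).
    by rewrite /pw (max_idPl wi) lerDl.
  rewrite -[leLHS]add0r lerD // /mw.
  have -> : w (tw i) - 2 / N%:R = - w i.
    rewrite /w (twP i).2 rmorphB /= -pmulrn -mul2n natrM; field.
    by rewrite gt_eqF.
  have nw : 0 <= - w i by rewrite oppr_ge0 ltW.
  by rewrite (max_idPl nw) !exprM sqrrN.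
have mw_pw i : mw i <= pw i.
  apply: lerXn2r; rewrite ?nnegrE ?max0_ge0 //.
  rewrite ge_max max0_ge0 andbT le_max gerBl.
  by rewrite divr_ge0 ?(ltW n0).
have twD i : D (tw i) = D i by rewrite /D (twP i).1.
have : \sum_i D i * w i ^+ (2 * k) <= \sum_i D i * (pw i + mw i).
  apply: (@le_trans _ _ (\sum_i (D i * pw i + D (tw i) * mw (tw i)))).
    by apply: ler_sum => i _; rewrite twD -mulrDr ler_wpM2l.
  have twE : \sum_i D (tw i) * mw (tw i) = \sum_i D i * mw i.
    by rewrite [RHS](reindex_inj tw_inj).
  by rewrite big_split /= twE -big_split; apply: ler_sum => i _ /=; rewrite mulrDr.
move/le_trans; apply.
rewrite (bigD1 i0) //= /D di0 mul1r.
have w0 : w i0 = 1 by rewrite /w zi0 -pmulrn natrX divff // expf_neq0 ?gt_eqF.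
have lnN : 0 <= ln N%:R :> R by apply: ln_ge0; rewrite ler1n.
have mw_i0 : mw i0 <= expR (- 4 * c).
  have le_e : Num.max (w i0 - 2 / N%:R) 0 <= expR (- (2 / N%:R)).
    by rewrite ge_max expR_ge0 andbT w0 expR_ge1Dx.
  apply: (@le_trans _ _ (expR (- (2 / N%:R)) ^+ (2 * k))).
    by apply: lerXn2r; rewrite ?nnegrE ?expR_ge0 ?max0_ge0.
  rewrite -expRM_natl ler_expR natrM.
  have : c <= k%:R / N%:R by rewrite ler_pdivlMr //; nra.
  have -> : 2 * k%:R * - (2 / N%:R) = - 4 * (k%:R / N%:R) :> R by field; lra.
  by nra.
pose b j : R := expR (15 / 16 * j%:R * ln (4 * j)%:R) / N%:R ^+ (2 * j).
have b0 j : 0 <= b j by rewrite divr_ge0 ?expR_ge0 ?exprn_ge0 ?ler0n.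
have pwi i : i != i0 -> pw i <= expR (- 4 * c) * b (N - l i)%N.
  move=> /lP[lN z1 z2]; rewrite /b mulrA ler_pdivlMr ?exprn_gt0 // mulrC.
  have jE : (N - l i)%:R = N%:R - (l i)%:R :> R by rewrite natrB // ltnW.
  have l_ge0 : 0 <= (l i)%:R :> R by apply: ler0n.
  have lNr : (l i)%:R < N%:R :> R by rewrite ltr_nat.
  apply: level_term_le => //; first by lia.
    rewrite ge_max expR_ge0 andbT; apply: le_trans (expR_ge1Dx _).
    rewrite /w ler_pdivrMr ?exprn_gt0 //.
    move: z2; rewrite -(ler_int R) !rmorphD rmorphN /= -!pmulrn -mul2n !natrX natrM jE => z2.
    apply: le_trans z2 _; rewrite le_eqVlt; apply/orP; left; apply/eqP.
    by field; lra.
  rewrite ge_max; apply/andP; split; last first.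
    by rewrite subr_ge0 ler_pdivrMr // jE; lra.
  rewrite /w ler_pdivrMr ?exprn_gt0 //.
  move: z1; rewrite -(ler_int R) -pmulrn natrM => z1; apply: le_trans z1 _.
  by rewrite le_eqVlt; apply/orP; left; apply/eqP; rewrite jE; field; lra.
(* Grouped by level: the squared degrees of level [N - j] sum to at most [N ^ (2 * j) / j!], whose
   numerator cancels the denominator of [b j]. *)
have sum_b : \sum_(i | i != i0) D i * b (N - l i)%N <= C.
  apply: (@le_trans _ _ (\sum_i \sum_(l0 < N | l i == l0) D i * b (N - l0)%N)).
    rewrite big_mkcond /=; apply: ler_sum => i _; case: ifPn => [/lP[lN _ _]|_].
      by rewrite (big_pred1 (Ordinal lN)).
    by apply: sumr_ge0 => l0 _; apply: mulr_ge0.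
  rewrite (exchange_big_dep predT) //=.
  apply: (@le_trans _ _ (\sum_(l0 < N) C / 2 ^+ (N - l0))); last first.
    rewrite -mulr_sumr -[leRHS]mulr1 ler_wpM2l ?(ltW C0) //.
    exact: sum_geometric_half.
  apply: ler_sum => l0 _; rewrite -mulr_suml.
  have j_gt0 : (0 < N - l0)%N by rewrite subn_gt0.
  apply: le_trans (CP _ j_gt0).
  apply: (@le_trans _ _ ((N%:R ^+ (2 * (N - l0)) / (N - l0)`!%:R) * b (N - l0)%N)).
    rewrite ler_wpM2r // -natr_sum; apply: le_trans (binomial_ffact_le _ _).
    by rewrite bin_sub ?ler_nat // ltnW.
  rewrite /b mulrC mulrA mulfVK //.
  by rewrite expf_neq0 ?gt_eqF.
have sum_le : \sum_(i | i != i0) D i * (pw i + mw i) <= 2 * C * expR (- 4 * c).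
  apply: (@le_trans _ _ (\sum_(i | i != i0) 2 * expR (- 4 * c) * (D i * b (N - l i)%N))).
    apply: ler_sum => i i_n0; rewrite mulrCA ler_wpM2l //.
    have := pwi i i_n0; have := mw_pw i; lra.
  rewrite -mulr_sumr mulrAC ler_wpM2r ?expR_ge0 //.
  by rewrite ler_wpM2l.
have -> : pw i0 = 1 by rewrite /pw w0 (max_idPl _) ?ler01 // expr1n.
rewrite mulrDl mul1r addrA lerD //; first by rewrite lerD2l.
Qed.

End RandomTranspositions.
(** * Convolution on a finite group *)

Section FiniteGroupConvolution.
Variables (R : realType) (T : finGroupType).
Implicit Types (P Q S : T -> R).

Lemma convolE P Q g : convol P Q g = \sum_u P u * Q (u^-1 * g)%g.
Proof.
rewrite /convol (reindex_inj invg_inj) /= (reindex_inj (mulgI g^-1)%g) /=.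
by apply: eq_bigr => u _; rewrite !invMg !invgK mulKVg.
Qed.

Lemma eq_convol P P' Q Q' : P =1 P' -> Q =1 Q' -> convol P Q =1 convol P' Q'.
Proof. by move=> eP eQ g; apply: eq_bigr => h _; rewrite eP eQ. Qed.

Lemma convolZr P Q (c : R) g : convol P (fun h => c * Q h) g = c * convol P Q g.
Proof. by rewrite mulr_sumr; apply: eq_bigr => h _; rewrite mulrCA. Qed.

Lemma convol_sumr (I : finType) P (Q : I -> T -> R) g :
  convol P (fun h => \sum_i Q i h) g = \sum_i convol P (Q i) g.
Proof. by rewrite exchange_big; apply: eq_bigr => h _; rewrite mulr_sumr. Qed.

Lemma convolA P Q S : convol P (convol Q S) =1 convol (convol P Q) S.
Proof.
move=> g; rewrite convolE [RHS]/convol.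
under eq_bigr do rewrite [convol Q S _]/convol mulr_sumr.
rewrite exchange_big; apply: eq_bigr => h _ /=.
rewrite convolE mulr_suml; apply: eq_bigr => u _.
by rewrite mulrA !mulgA.
Qed.

Lemma convol_delta_r P : convol P (fun g => (g == 1%g)%:R) =1 P.
Proof.
move=> g; rewrite /convol (bigD1 1%g) //= eqxx mulr1 invg1 mulg1.
by rewrite big1 ?addr0 // => h /negPf->; rewrite mulr0.
Qed.

Lemma convol_delta_l P : convol (fun g => (g == 1%g)%:R) P =1 P.
Proof.
move=> g; rewrite convolE (bigD1 1%g) //= eqxx mul1r invg1 mul1g.
by rewrite big1 ?addr0 // => h /negPf->; rewrite mul0r.
Qed.

Lemma convol_powD P k m :
  convol_pow P (k + m) =1 convol (convol_pow P k) (convol_pow P m).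
Proof.
elim: k => [|k IHk] g; first by rewrite add0n convol_delta_l.
rewrite addSn /= -[RHS]convolA; exact: eq_convol.
Qed.

Lemma convol_powSr P k : convol_pow P k.+1 =1 convol (convol_pow P k) P.
Proof.
move=> g; rewrite -addn1 convol_powD; apply: eq_convol => // h.
by rewrite /= convol_delta_r.
Qed.

Lemma convol_pow_inv P k : (forall g, P g^-1%g = P g) ->
  forall g, convol_pow P k g^-1%g = convol_pow P k g.
Proof.
move=> Pinv; elim: k => [|k IHk] g; first by rewrite /= eq_invg1.
rewrite convol_powSr convolE /= [RHS]/convol [RHS](reindex_inj invg_inj) /=.
by apply: eq_bigr => u _; rewrite invgK -invMg Pinv IHk mulrC.
Qed.

Lemma sum_convol P Q : \sum_g convol P Q g = (\sum_g P g) * \sum_g Q g.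
Proof.
rewrite exchange_big mulr_sumr; apply: eq_bigr => h _ /=.
by rewrite -mulr_suml [in RHS](reindex_inj (mulIg h^-1%g)).
Qed.

Lemma sum_convol_pow P k : \sum_g P g = 1 -> \sum_g convol_pow P k g = 1.
Proof.
move=> P1; elim: k => [|k IHk]; last by rewrite sum_convol P1 IHk mul1r.
by rewrite (bigD1 1%g) //= eqxx big1 ?addr0 // => g /negPf->.
Qed.

(** For symmetric [P], the value of the [2k]-fold power at 1 is the sum of the squares of the
    [k]-fold power; the cross and constant terms of the expanded square leave [- 1]. *)
Lemma l2_dist_unif P k (c : R) :
    (forall g, P g^-1%g = P g) -> \sum_g P g = 1 -> c = #|T|%:R^-1 ->
  #|T|%:R * l2_dist (convol_pow P k) (fun=> c) ^+ 2
    = #|T|%:R * convol_pow P (2 * k) 1%g - 1.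
Proof.
move=> Pinv P1 cE; rewrite sqr_sqrtr; last first.
  by apply: sumr_ge0 => g _; rewrite exprn_ge0.
have T_n0 : #|T|%:R != 0 :> R by rewrite pnatr_eq0 -lt0n; apply/card_gt0P; exists 1%g.
have Tc : #|T|%:R * c = 1 by rewrite cE divff.
pose Q := convol_pow P k.
have -> : convol_pow P (2 * k) 1%g = \sum_g Q g ^+ 2.
  rewrite mul2n -addnn convol_powD; apply: eq_bigr => h _.
  by rewrite mul1g convol_pow_inv.
have -> : \sum_g `|Q g - c| ^+ 2 = \sum_g (Q g ^+ 2 + c * (c - 2 * Q g)).
  by apply: eq_bigr => g _; rewrite real_normK ?num_real //; ring.
rewrite big_split /= -mulr_sumr sumrB sumr_const -mulr_sumr sum_convol_pow //.
rewrite mulrDr mulrA Tc mul1r; congr (_ + _).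
have -> : c *+ #|T| = 1 by rewrite -mulr_natl.
by ring.
Qed.

(* The total masses agree, so [P - Q] has the same sum, up to sign, over [A] and
   over its complement: this is where the factor [1 / 2] comes from. *)
Lemma tv_dist_le_l2 P Q : \sum_g P g = \sum_g Q g ->
  tv_dist P Q <= 1 / 2 * Num.sqrt #|T|%:R * l2_dist P Q.
Proof.
move=> ePQ; pose d g := P g - Q g.
have d0 : \sum_g d g = 0 by rewrite sumrB ePQ subrr.
(* Cauchy-Schwarz, from the nonnegativity of the sum of the [(#|T| * |d g| - a) ^ 2]. *)
have CS : (\sum_g `|d g|) ^+ 2 <= #|T|%:R * \sum_g `|d g| ^+ 2.
  pose a := \sum_g `|d g|.
  have : 0 <= \sum_g (#|T|%:R * `|d g| - a) ^+ 2 by apply: sumr_ge0 => g _; apply: sqr_ge0.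
  have -> : \sum_g (#|T|%:R * `|d g| - a) ^+ 2
      = \sum_g (#|T|%:R ^+ 2 * `|d g| ^+ 2 + ((- 2 * #|T|%:R * a) * `|d g| + a ^+ 2)).
    by apply: eq_bigr => g _; ring.
  rewrite !big_split /= -!mulr_sumr -/a sumr_const -[a *+ _]mulr_natl.
  have T0 : 0 < #|T|%:R :> R by rewrite ltr0n; apply/card_gt0P; exists 1%g.
  by nra.
have half (A : {set T}) : `|\sum_(g in A) P g - \sum_(g in A) Q g| <= 1 / 2 * \sum_g `|d g|.
  rewrite -sumrB; pose a := \sum_(g in A) d g; pose a' := \sum_(g in ~: A) d g.
  have aa' : a' = - a.
    apply/eqP; rewrite -addr_eq0 addrC -d0 [X in _ == X](bigID [in A]) /=.
    by apply/eqP; congr (_ + _); apply: eq_bigl => g; rewrite in_setC.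
  have la : `|a| <= \sum_(g in A) `|d g| by apply: ler_norm_sum.
  have la' : `|a| <= \sum_(g in ~: A) `|d g| by rewrite -normrN -aa'; apply: ler_norm_sum.
  have -> : \sum_g `|d g| = \sum_(g in A) `|d g| + \sum_(g in ~: A) `|d g|.
    rewrite (bigID [in A]) /=; congr (_ + _).
    by apply: eq_bigl => g; rewrite in_setC.
  rewrite -/(d _) -/a; lra.
(* The maximum in [tv_dist] starts from the default 0, which the bound must also dominate. *)
have B0 : 0 <= 1 / 2 * \sum_g `|d g| by apply: mulr_ge0; [rewrite divr_ge0 | apply: sumr_ge0].
apply: (@le_trans _ _ (1 / 2 * \sum_g `|d g|)).
  rewrite /tv_dist; elim/big_ind: _ => // x y hx hy.
  by rewrite ge_max hx.
rewrite -[leRHS]mulrA ler_wpM2l ?divr_ge0 // -sqrtrM ?ler0n //.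
rewrite -[leLHS]ger0_norm ?sumr_ge0 // -sqrtr_sqr.
exact: ler_wsqrtr.
Qed.

End FiniteGroupConvolution.
(** * The independent shuffles walk *)

Lemma tperm_eq1 (X : finType) (p q : X) : (tperm p q == 1%g) = (p == q).
Proof.
apply/eqP/eqP => [pq|->]; last exact: tperm1.
by rewrite -[LHS]perm1 -pq tpermL.
Qed.

Lemma eq_tperm (X : finType) (p q x y : X) : p != q ->
  (tperm p q == tperm x y) = ((x, y) == (p, q)) || ((x, y) == (q, p)).
Proof.
move=> pq; apply/eqP/orP => [e|[/eqP[-> ->]//|/eqP[-> ->]]]; last exact: tpermC.
have := congr1 (fun s : {perm X} => s p) e; rewrite /= tpermL.
case: tpermP => [px qy|py qx|_ _ qp]; last by rewrite qp eqxx in pq.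
  by left; rewrite px qy.
by right; rewrite py qx.
Qed.

Section Wreath.
Variables (R : realType) (gT : finGroupType) (n : nat).
Hypothesis n_gt0 : (0 < n)%N.
Local Notation P := (@indep_shuffles R gT n).
Local Notation g := (#|gT|%:R : R).
Implicit Types (u v w : wreath gT n).

Lemma card_gT_neq0 : g != 0.
Proof. by rewrite pnatr_eq0 -lt0n; apply/card_gt0P; exists 1%g. Qed.

(** The walk as a mixture over independent uniform [p] and [q]. The three masses come from counting
    pairs: [n] diagonal ones for the identity, one for a single nontrivial entry, two ordered ones
    for a transposition. *)
Lemma indep_shufflesE u : P u = (n%:R ^+ 2)^-1 *
  \sum_p \sum_q ((wperm u == tperm p q) && (wsupp u \subset [set p; q]))%:R
     / g ^+ #|[set p; q]|.
Proof.
have n0 : n%:R != 0 :> R by rewrite pnatr_eq0 -lt0n.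
have g0 := card_gT_neq0.
have is0 : #|wsupp u| = 0%N -> wsupp u = set0 by move/eqP; rewrite cards_eq0 => /eqP.
rewrite /indep_shuffles; have [u1|u1] /= := eqVneq (wperm u) 1%g.
  have -> : is_shuffled_transposition u = false.
    apply/existsP=> -[p /existsP[q /and3P[pq]]].
    by rewrite u1 eq_sym tperm_eq1 (negPf pq).
  have -> : \sum_p \sum_q ((wperm u == tperm p q) && (wsupp u \subset [set p; q]))%:R
     / g ^+ #|[set p; q]| = \sum_(p | wsupp u \subset [set p]) g^-1.
    rewrite [RHS]big_mkcond; apply: eq_bigr => p _; rewrite (bigD1 p) //=.
    rewrite big1 => [|q qp]; last first.
      by rewrite u1 eq_sym tperm_eq1 eq_sym (negPf qp) mul0r.
    rewrite addr0 tperm1 u1 eqxx setUid cards1 expr1 /=.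
    by case: ifP => _; rewrite ?mul1r ?mul0r.
  rewrite sumr_const; have [/eqP/is0->|S0] /= := ifPn (#|wsupp u| == 0)%N.
    have -> : #|[pred p : 'I_n | set0 \subset [set p]]| = n.
      by rewrite -[RHS]card_ord; apply: eq_card => p; rewrite !inE sub0set.
    by rewrite -mulr_natr; field; rewrite ?n0 ?g0.
  have [/cards1P[p ->]|S1] /= := ifPn (#|wsupp u| == 1)%N.
    have -> : #|[pred q : 'I_n | [set p] \subset [set q]]| = 1%N.
      by rewrite -[RHS](card1 p); apply: eq_card => q; rewrite !inE sub1set inE eq_sym.
    by rewrite mulr1n; field; rewrite ?n0 ?g0.
  have -> : #|[pred p : 'I_n | wsupp u \subset [set p]]| = 0%N; last by rewrite mulr0n mulr0.
  apply: eq_card0 => p; rewrite !inE; apply: contraNF S1 => /subset_leq_card.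
  by rewrite cards1; move: S0; case: #|_| => [|[]].
have [/existsP[p /existsP[q /and3P[pq /eqP uE Su]]]|no] := ifPn (is_shuffled_transposition u).
  rewrite pair_big /= (bigD1 (p, q)) //= (bigD1 (q, p)) /=; last first.
    by rewrite xpair_eqE eq_sym (negPf pq) andbF.
  rewrite big1 => [|[x y] /= /andP[xy1 xy2]]; last first.
    by rewrite uE eq_tperm // (negPf xy1) (negPf xy2) mul0r.
  rewrite uE eqxx tpermC eqxx Su [[set q; p]]setUC Su cards2 pq /=.
  by field; rewrite ?n0 ?g0.
rewrite big1 ?mulr0 // => p _; apply: big1 => q _.
case: eqP => [uE|]; rewrite ?mul0r //=; have [Su|] := boolP (wsupp u \subset _); rewrite ?mul0r //.
case/negP: no; apply/existsP; exists p; apply/existsP; exists q.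
by rewrite uE eqxx Su -tperm_eq1 -uE u1.
Qed.

Lemma indep_shuffles_inv u : P u^-1%g = P u.
Proof.
rewrite !indep_shufflesE; congr (_ * _); apply: eq_bigr => p _; apply: eq_bigr => q _.
congr (_%:R / _); rewrite /= (inv_eq invgK) tpermV.
case: eqP => //= uE; congr nat_of_bool.
have tS i : (tperm p q i \in [set p; q]) = (i \in [set p; q]).
  by rewrite !inE; case: tpermP => [->|->|//]; rewrite !eqxx ?orbT.
apply/subsetP/subsetP => sub i; rewrite inE => ui.
  rewrite -tS; apply: sub; rewrite inE ffunE uE tpermK.
  by rewrite eq_invg1.
rewrite -tS; apply: sub; move: ui; rewrite inE ffunE uE.
by rewrite eq_invg1.
Qed.

(* Left multiplication by a step resamples the coordinates [p] and [q], so that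
   a product function stays a product function. *)
Lemma convol_indep_shuffles (f : 'I_n -> gT -> R) (F : 'S_n -> R) w :
  convol P (fun v => (\prod_i f i (wbase v i)) * F (wperm v)) w =
  (n%:R ^+ 2)^-1 * \sum_p \sum_q F (wperm w * tperm p q)%g *
    \prod_i (if i \in [set p; q] then g^-1 * \sum_a f (tperm p q i) a
             else f i (wbase w i)).
Proof.
have g0 := card_gT_neq0.
have sum2_mul (A : 'I_n -> 'I_n -> R) c :
    (\sum_p \sum_q A p q) * c = \sum_p \sum_q A p q * c.
  by rewrite mulr_suml; apply: eq_bigr => p _; rewrite mulr_suml.
rewrite convolE; under eq_bigr => u _ do rewrite indep_shufflesE -mulrA sum2_mul.
rewrite -mulr_sumr; congr (_ * _).
rewrite exchange_big; apply: eq_bigr => p _; rewrite exchange_big; apply: eq_bigr => q _ /=.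
pose t := tperm p q; pose S := [set p; q].
(* The values a step may take at [i]; distributivity turns the product of sums over [Q i] into a sum
   over the steps supported in [S]. *)
pose Q (i : 'I_n) : pred gT := if i \in S then predT else pred1 1%g.
pose x := wbase w.
have -> : \prod_i (if i \in S then g^-1 * \sum_a f (t i) a else f i (x i))
    = \prod_i ((if i \in S then g^-1 else 1) *
        \sum_(a | Q i a) f (t i) (a^-1 * x i)%g).
  apply: eq_bigr => i _; rewrite /Q; case: ifPn => [_|iS].
    congr (_ * _); rewrite [LHS](reindex_inj (mulIg (x i))) /=.
    by rewrite [LHS](reindex_inj invg_inj).
  rewrite mul1r big_pred1_eq invg1 mul1g /t tpermD //.
    by apply: contraNneq iS => <-; rewrite !inE eqxx.
  by apply: contraNneq iS => <-; rewrite !inE eqxx orbT.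
rewrite big_split /= -big_mkcond /= prodr_const bigA_distr_big_dep.
rewrite mulrCA !mulr_sumr.
pose h (y : {ffun 'I_n -> gT}) := Wreath y t.
rewrite (bigID (fun u => (wperm u == t) && (wsupp u \subset S))) /=.
rewrite [X in _ + X]big1 => [|u /negPf->]; last by rewrite !mul0r.
rewrite addr0 (reindex_onto h (fun u => wbase u)) /=; last first.
  by move=> [y s] /andP[/eqP/= -> _].
apply: eq_big => [y|y].
  rewrite !eqxx andbT /=; apply/subsetP/familyP => yS i.
    rewrite /Q; case: ifPn => // iS; rewrite unfold_in /= -[_ == _]negbK.
    by apply: contra iS => yi; apply: yS; rewrite inE.
  have := yS i; rewrite /Q; case: ifP => // _; rewrite unfold_in /= => /eqP yi.
  by rewrite inE /= yi eqxx.
rewrite !eqxx andbT /= => ->; rewrite mul1r exprVn; congr (_ * _).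
rewrite mulrC /t tpermV; congr (_ * _).
rewrite (reindex_inj (@perm_inj _ t)) /=; apply: eq_bigr => i _.
by rewrite !ffunE /t ?tpermV !tpermK.
Qed.

(** The total mass is the convolution with the constant function 1, read at the identity. *)
Lemma sum_indep_shuffles : \sum_u P u = 1.
Proof.
have g0 := card_gT_neq0.
have := @convol_indep_shuffles (fun _ _ => 1) (fun=> 1) 1%g.
rewrite convolE => e; rewrite -[RHS](_ : \sum_u P u * (\prod_(i < n) 1 * 1) = 1).
  by apply: eq_bigr => u _; rewrite big1_eq !mulr1.
rewrite e; under eq_bigr => p _.
  under eq_bigr => q _.
    rewrite mul1r big1 => [|i _]; last by case: ifP => //; rewrite sumr_const mulVf.
    over.
  over.
rewrite !sumr_const card_ord -mulrnA mulnn natrX mulVf // expf_neq0 //.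
by rewrite pnatr_eq0 -lt0n.
Qed.

(* For [S] a set of positions, [coord_factor S] is the tensor product of the projections
   of the delta mass onto the constants (in [S]) and their complement (off [S]). *)
Definition coord_factor (S : {set 'I_n}) (i : 'I_n) (a : gT) : R :=
  if i \in S then g^-1 else (a == 1%g)%:R - g^-1.

Lemma sum_coord_factor S i : \sum_a coord_factor S i a = (i \in S)%:R.
Proof.
have g0 := card_gT_neq0.
rewrite /coord_factor; case: (i \in S); first by rewrite sumr_const -[g^-1 *+ _]mulr_natl divff.
have -> : \sum_(a : gT) ((a == 1%g)%:R - g^-1) = \sum_(a : gT) (a == 1%g)%:R - 1 :> R.
  by rewrite sumrB sumr_const -[g^-1 *+ _]mulr_natl divff.
by rewrite (bigD1 1%g) //= eqxx big1 ?addr0 ?subrr // => a /negPf->.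
Qed.

(** A factor off [S] has sum 0, so resampling it kills the product, while a constant factor is
    unchanged: only [p] and [q] in [S] survive. The inverse turns right multiplication by
    [tperm p q] into the left multiplication of [walks]. *)
Lemma convol_coord_factor S m w :
  convol P (fun v => (\prod_i coord_factor S i (wbase v i)) * (walks S m (wperm v)^-1%g)%:R) w =
  (n%:R ^+ 2)^-1 *
    ((\prod_i coord_factor S i (wbase w i)) * (walks S m.+1 (wperm w)^-1%g)%:R).
Proof.
rewrite (convol_indep_shuffles (coord_factor S) (fun s => (walks S m s^-1%g)%:R)); congr (_ * _).
rewrite /= natr_sum mulr_sumr [RHS]big_mkcond; apply: eq_bigr => p _ /=.
have prod0 q i : i \in [set p; q] -> tperm p q i \notin S ->
    \prod_i (if i \in [set p; q] then g^-1 * \sum_a coord_factor S (tperm p q i) a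
             else coord_factor S i (wbase w i)) = 0.
  move=> ipq tiS; rewrite (bigD1 i) //= ipq sum_coord_factor (negPf tiS) mulr0.
  by rewrite mul0r.
case: ifPn => pS; last first.
  apply: big1 => q _; rewrite (prod0 q q) ?mulr0 //.
    by rewrite !inE eqxx orbT.
  by rewrite tpermR.
rewrite natr_sum mulr_sumr [RHS]big_mkcond; apply: eq_bigr => q _ /=.
case: ifPn => qS; last first.
  rewrite (prod0 q p) ?mulr0 //.
    by rewrite !inE eqxx.
  by rewrite tpermL.
rewrite invMg tpermV mulrC; congr (_ * _); apply: eq_bigr => i _.
rewrite sum_coord_factor; case: ifPn => // /set2P[->|->].
  by rewrite tpermL qS mulr1 /coord_factor pS.
by rewrite tpermR pS mulr1 /coord_factor qS.
Qed.

(** At [m = 0] the delta mass at each coordinate is the sum of its two projections, and the product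
    expands over the subsets [S]. *)
Lemma convol_pow_shuffles m w :
  convol_pow P m w = (n%:R ^+ 2)^-1 ^+ m *
    \sum_S (\prod_i coord_factor S i (wbase w i)) * (walks S m (wperm w)^-1%g)%:R.
Proof.
elim: m w => [|m IHm] w /=.
  rewrite expr0 mul1r -mulr_suml eq_invg1.
  have -> : \sum_S \prod_i coord_factor S i (wbase w i) = \prod_i (wbase w i == 1%g)%:R.
    rewrite -bigA_distr; apply: eq_bigr => i _.
    by rewrite /= addrCA subrr addr0.
  have [->|w1] := eqVneq w 1%g.
    by rewrite big1 ?eqxx ?mul1r // => i _; rewrite ffunE eqxx.
  have [s1|_] := eqVneq (wperm w) 1%g; last by rewrite mulr0.
  have [i wi] : exists i, wbase w i != 1%g.
    apply/existsP; apply: contraNT w1 => /existsPn w1; apply/eqP.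
    case: w s1 w1 => x s /= -> w1; congr Wreath; apply/ffunP=> i.
    by rewrite ffunE; apply/eqP; rewrite -[_ == _]negbK.
  by rewrite (bigD1 i) //= (negPf wi) !mul0r.
pose f S (v : wreath gT n) : R :=
  (\prod_i coord_factor S i (wbase v i)) * (walks S m (wperm v)^-1%g)%:R.
have -> : convol P (convol_pow P m) w
    = convol P (fun v => (n%:R ^+ 2)^-1 ^+ m * \sum_S f S v) w.
  exact: eq_convol.
rewrite convolZr convol_sumr [_ ^+ m.+1]exprSr -mulrA; congr (_ * _); rewrite mulr_sumr.
by apply: eq_bigr => S _; rewrite convol_coord_factor.
Qed.

Lemma convol_pow_shuffles1 m :
  (#|gT| ^ n * n`!)%N%:R * convol_pow P m 1%g =
  \sum_(S : {set 'I_n}) n`!%:R * (g - 1) ^+ (n - #|S|) *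
     (walks S m 1%g)%:R / (n%:R ^+ 2) ^+ m.
Proof.
have g0 := card_gT_neq0.
rewrite convol_pow_shuffles !mulr_sumr; apply: eq_bigr => S _.
have -> : \prod_i coord_factor S i (wbase (1%g : wreath gT n) i)
    = (g - 1) ^+ (n - #|S|) / g ^+ n.
  have cS : #|~: S| = (n - #|S|)%N by rewrite cardsCs setCK card_ord.
  have -> : \prod_i coord_factor S i (wbase (1%g : wreath gT n) i)
      = \prod_i (g^-1 * (if i \in ~: S then g - 1 else 1)).
    have b1 i : wbase (1%g : wreath gT n) i = 1%g by rewrite ffunE.
    apply: eq_bigr => i _; rewrite b1 /coord_factor eqxx inE; case: (i \in S) => /=.
      by rewrite mulr1.
    by rewrite mulrBr mulVf // mulr1.
  rewrite big_split /= -big_mkcond /= !prodr_const card_ord cS exprVn.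
  by rewrite mulrC.
have -> : (wperm (1%g : wreath gT n))^-1%g = 1%g by rewrite invg1.
rewrite natrM natrX exprVn mulrA mulrACA mulrA.
set a := g ^+ n; have a0 : a != 0 by rewrite expf_neq0.
by field; rewrite a0 expf_neq0 ?expf_neq0 ?pnatr_eq0 -?lt0n.
Qed.

End Wreath.

(** * Summation over sets of positions and the final bound *)

(** The choice of [k] makes [expR (- (4 * k / n))] equal to [expR (- 4 * c) / (n ^ 2 * (q - 1))].
    Its power [n - j] dominates [(j / n) ^ (4 * k)], and it outweighs both [n! / j! <= n ^ (n - j)]
    and the power of [q - 1]. *)
Lemma partial_walks_le (R : realType) (C : R) (n j k q : nat) (W c : R) :
    (0 < j < n)%N -> (2 <= q)%N -> 0 <= c -> 0 <= C -> 0 <= W ->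
    k%:R = 1 / 2 * n%:R * ln n%:R + 1 / 4 * n%:R * ln (q%:R - 1) + c * n%:R ->
    j`!%:R * W / (j%:R ^+ 2) ^+ (2 * k) <= 1 + C ->
  n`!%:R * (q%:R - 1) ^+ (n - j) * W / (n%:R ^+ 2) ^+ (2 * k)
    <= (1 + C) * expR (- 4 * c) * n%:R^-1 ^+ (n - j).
Proof.
move=> /andP[j0 jn] q2 c0 C0 W0 hk Wle.
set i := (n - j)%N; set a : R := q%:R - 1; set y : R := n%:R; set x : R := j%:R.
have a1 : 1 <= a by have : 2 <= q%:R :> R; [rewrite ler_nat | rewrite /a; lra].
have y1 : 1 <= y by rewrite ler1n; lia.
have x1 : 1 <= x by rewrite ler1n.
have f0 : 0 < j`!%:R :> R by rewrite ltr0n fact_gt0.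
have i0 : (0 < i)%N by rewrite subn_gt0.
have iE : i%:R = y - x :> R by rewrite natrB // ltnW.
pose X := expR (- (4 * k%:R / y)).
have XE : X = (y ^+ 2)^-1 * a^-1 * expR (- 4 * c).
  have -> : X = expR (- (ln y + ln y + ln a)) * expR (- 4 * c).
    by rewrite /X hk -expRD; congr expR; rewrite -/y -/a; field; lra.
  have ly : expR (ln y) = y by rewrite lnK // posrE; lra.
  have la : expR (ln a) = a by rewrite lnK // posrE; lra.
  by rewrite expRN !expRD ly la expr2 invfM.
have ratio : (x / y) ^+ (4 * k) <= X ^+ i.
  have xy : x / y <= expR (- (i%:R / y)).
    apply: le_trans (expR_ge1Dx _); rewrite iE le_eqVlt; apply/orP; left.
    by apply/eqP; field; lra.
  apply: (@le_trans _ _ (expR (- (i%:R / y)) ^+ (4 * k))).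
    by rewrite lerXn2r ?nnegrE ?expR_ge0 // divr_ge0; lra.
  rewrite /X -!expRM_natl natrM le_eqVlt; apply/orP; left.
  by apply/eqP; congr expR; ring.
have nj : n`!%:R = (n ^_ i)%:R * j`!%:R :> R.
  by rewrite -natrM -(ffact_fact (leq_subr j n)) subKn // ltnW.
have ffle : (n ^_ i)%:R <= y ^+ i by rewrite -natrX ler_nat ffact_le_expn.
have pw (z : R) : (z ^+ 2) ^+ (2 * k) = z ^+ (4 * k) by rewrite -exprM mulnA.
rewrite !pw in Wle *.
have x40 : 0 < x ^+ (4 * k) by rewrite exprn_gt0; lra.
have y40 : 0 < y ^+ (4 * k) by rewrite exprn_gt0; lra.
have jW : j`!%:R * W <= (1 + C) * x ^+ (4 * k) by rewrite -ler_pdivrMr.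
have ai0 : 0 <= a ^+ i by rewrite exprn_ge0; lra.
have yi0 : 0 <= y ^+ i by rewrite exprn_ge0; lra.
apply: (@le_trans _ _ (y ^+ i * a ^+ i * ((1 + C) * (x / y) ^+ (4 * k)))).
  have -> : n`!%:R * a ^+ i * W / y ^+ (4 * k)
      = ((n ^_ i)%:R * a ^+ i) * (j`!%:R * W / y ^+ (4 * k)) by rewrite nj; ring.
  apply: ler_pM.
  - by rewrite mulr_ge0.
  - by rewrite divr_ge0 ?(ltW y40) // mulr_ge0 // ltW.
  - by rewrite ler_wpM2r.
  by rewrite expr_div_n mulrA ler_wpM2r // invr_ge0 ltW.
have C1 : 0 <= 1 + C by lra.
apply: (@le_trans _ _ (y ^+ i * a ^+ i * ((1 + C) * X ^+ i))).
  by rewrite ler_wpM2l ?mulr_ge0 // ler_wpM2l.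
have -> : y ^+ i * a ^+ i * ((1 + C) * X ^+ i)
    = (1 + C) * (expR (- 4 * c) ^+ i) * y^-1 ^+ i.
  rewrite mulrCA -mulrA; congr (_ * _); rewrite -!exprMn; congr (_ ^+ i).
  by rewrite XE; field; lra.
rewrite ler_wpM2r ?exprn_ge0 ?invr_ge0 //.
(* As [i >= 1], one factor [expR (- 4 * c)] is kept and the others are bounded by 1. *)
rewrite ler_wpM2l // -[leRHS]expr1 ler_wiXn2l ?expR_ge0 //.
by rewrite expR_le1; lra.
Qed.

Lemma indep_shuffles_return_le (R : realType) : exists2 B : R, 0 < B &
  forall (gT : finGroupType) (n k : nat) (c : R),
    (2 <= #|gT|)%N -> (1 <= n)%N -> 0 < c ->
    k%:R = 1 / 2 * n%:R * ln n%:R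
           + 1 / 4 * n%:R * ln (#|gT|%:R - 1) + c * n%:R :> R ->
  (#|gT| ^ n * n`!)%N%:R * convol_pow (@indep_shuffles R gT n) (2 * k) 1%g - 1
    <= B * expR (- 4 * c).
Proof.
have [C C0 CP] := walks_le R.
(* [C] comes from the full set of positions. For the proper subsets, the sum of [n ^ - (n - #|S|)]
   is at most [(1 + 1 / n) ^ n <= e]. *)
exists (C + (1 + C) * expR 1).
  by rewrite addr_gt0 // mulr_gt0 ?expR_gt0 // addr_gt0.
move=> gT n k c g2 n1 c0 hk.
set a : R := #|gT|%:R - 1 in hk *.
have a1 : 1 <= a by have : 2 <= #|gT|%:R :> R; [rewrite ler_nat | rewrite /a; lra].
have lna : 0 <= ln a by apply: ln_ge0.
have y1 : 1 <= n%:R :> R by rewrite ler1n.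
have lny : 0 <= ln n%:R :> R by apply: ln_ge0.
have k0 : (0 < k)%N.
  by rewrite -(ltr0n R) hk; nra.
rewrite convol_pow_shuffles1 // (bigD1 setT) //= cardsT card_ord subnn expr0 mulr1.
have full : n`!%:R * (walks [set: 'I_n] (2 * k) 1%g)%:R / (n%:R ^+ 2) ^+ (2 * k)
    <= 1 + C * expR (- 4 * c).
  have := CP _ [set: 'I_n] k c; rewrite cardsT card_ord natrM; apply=> //.
    exact: ltW.
  by rewrite hk; nra.
have rest : \sum_(S : {set 'I_n} | S != setT) n`!%:R * a ^+ (n - #|S|) *
     (walks S (2 * k) 1%g)%:R / (n%:R ^+ 2) ^+ (2 * k)
     <= (1 + C) * expR 1 * expR (- 4 * c).
  apply: (@le_trans _ _ (\sum_(S : {set 'I_n}) (1 + C) * expR (- 4 * c) * n%:R^-1 ^+ (n - #|S|))).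
    rewrite big_mkcond /=; apply: ler_sum => S _.
    have bound0 : 0 <= (1 + C) * expR (- 4 * c) * n%:R^-1 ^+ (n - #|S|).
      by rewrite !mulr_ge0 ?expR_ge0 ?exprn_ge0 ?invr_ge0 //; lra.
    case: ifP => // ST.
    have Sn : (#|S| < n)%N.
      have : (#|S| < #|[set: 'I_n]|)%N by rewrite proper_card // properT ST.
      by rewrite cardsT card_ord.
    (* The empty set, outside the scope of [walks_le], admits no walk since [2 * k > 0]. *)
    have [S0|S0] := posnP #|S|.
      have -> : walks S (2 * k) 1%g = 0%N; last by rewrite mulr0 mul0r.
      have /eqP -> : S == set0 by rewrite -cards_eq0 S0.
      have -> : (2 * k = (2 * k).-1.+1)%N by lia.
      by rewrite /= big_set0.
    apply: partial_walks_le => //; [by rewrite S0 | exact: ltW | exact: ltW |].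
    (* A bound by [1 + C] is enough for a proper subset, so [walks_le] is used at [c = 0]; the decay
       comes from [partial_walks_le]. *)
    have := CP _ S k 0 S0 (lexx 0); rewrite mul0r addr0 mulr0 expR0 mulr1 natrM.
    apply; rewrite hk.
    have Sy : #|S|%:R <= n%:R :> R by rewrite ler_nat ltnW.
    have S1 : 1 <= #|S|%:R :> R by rewrite ler1n.
    have : ln #|S|%:R <= ln n%:R :> R by rewrite ler_ln ?posrE; lra.
    have : 0 <= ln #|S|%:R :> R by apply: ln_ge0.
    nra.
  rewrite -mulr_sumr [(1 + C) * expR 1 * _]mulrAC ler_wpM2l ?mulr_ge0 ?expR_ge0 //.
    by lra.
  have -> : \sum_(S : {set 'I_n}) n%:R^-1 ^+ (n - #|S|)
      = \prod_(i < n) (1 + n%:R^-1) :> R.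
    rewrite bigA_distr; apply: eq_bigr => S _.
    have -> : (n - #|S|)%N = #|~: S| by rewrite [RHS]cardsCs setCK card_ord.
    rewrite -prodr_const big_mkcond; apply: eq_bigr => i _.
    by rewrite inE; case: (i \in S).
  rewrite prodr_const card_ord.
  apply: (@le_trans _ _ (expR n%:R^-1 ^+ n)).
    by rewrite lerXn2r ?nnegrE ?expR_ge0 ?expR_ge1Dx // addr_ge0 ?invr_ge0.
  by rewrite -expRM_natl divff //; lra.
rewrite lerBlDl; apply: le_trans (lerD full rest) _.
by rewrite le_eqVlt; apply/orP; left; apply/eqP; ring.
Qed.

Theorem theorem3p1p3 (R : realType) :
  exists b : R, 0 < b /\
    forall (gT : finGroupType) (n k : nat) (c : R),
      (2 <= #|gT|)%N -> (1 <= n)%N -> 0 < c ->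
      k%:R = 1 / 2 * n%:R * ln n%:R
             + 1 / 4 * n%:R * ln (#|gT|%:R - 1) + c * n%:R :> R ->
      let P : wreath gT n -> R := @indep_shuffles R gT n in
      let U : wreath gT n -> R := @wreath_unif R gT n in
      let Pk := convol_pow P k in
      tv_dist Pk U <= 1 / 2 * Num.sqrt (#|gT| ^ n * n`!)%N%:R * l2_dist Pk U /\
      1 / 2 * Num.sqrt (#|gT| ^ n * n`!)%N%:R * l2_dist Pk U <= b * expR (- 2 * c).
Proof.
have [B B0 BP] := indep_shuffles_return_le R.
(* [B] bounds a squared distance with rate [- 4 * c]; the square root gives rate [- 2 * c]. *)
exists (Num.sqrt B); split; first by rewrite sqrtr_gt0.
move=> gT n k c g2 n1 c0 hk P U Pk.
have card_W : #|{: wreath gT n}| = (#|gT| ^ n * n`!)%N by apply: card_wreath.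
have W0 : 0 < (#|gT| ^ n * n`!)%N%:R :> R.
  by rewrite ltr0n muln_gt0 expn_gt0 fact_gt0 andbT; lia.
have P1 : \sum_u P u = 1 by apply: sum_indep_shuffles.
split.
  rewrite -card_W; apply: tv_dist_le_l2; rewrite sum_convol_pow //.
  by rewrite sumr_const card_W -[_ *+ _]mulr_natl divff // gt_eqF.
have l2E : (#|gT| ^ n * n`!)%N%:R * l2_dist Pk U ^+ 2 <= B * expR (- 4 * c).
  apply: le_trans (BP _ _ _ _ g2 n1 c0 hk).
  have := @l2_dist_unif R (wreath gT n) P k ((#|gT| ^ n * n`!)%N%:R)^-1 _ P1.
  rewrite card_W => <- //; exact: indep_shuffles_inv.
have l2_ge0 : 0 <= l2_dist Pk U by apply: sqrtr_ge0.
set M := Num.sqrt (#|gT| ^ n * n`!)%N%:R * l2_dist Pk U.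
have M0 : 0 <= M by rewrite mulr_ge0 ?sqrtr_ge0.
have : M <= Num.sqrt B * expR (- 2 * c).
  rewrite -(@ler_pXn2r _ 2) ?nnegrE ?mulr_ge0 ?sqrtr_ge0 ?expR_ge0 //.
  rewrite !exprMn (sqr_sqrtr (ltW B0)) (sqr_sqrtr (ltW W0)).
  have -> : expR (- 2 * c) ^+ 2 = expR (- 4 * c).
    by rewrite -expRM_natl; congr expR; ring.
  exact: l2E.
by rewrite -mulrA -/M; lra.
Qed.
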